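(* Let $K$ be a field, $n>1$ an integer, and $A=KQ/I$, where $Q$ is the quiver with vertices $1,2,3$ and arrows $\varepsilon:1\to1$, $\alpha_1:1\to2$, $\beta_1:2\to1$, $\alpha_2:2\to3$, $\beta_2:3\to2$, and \[ I=\langle \alpha_2\alpha_1,\ \beta_1\beta_2,\ \beta_2\alpha_2-\alpha_1\beta_1,\ \varepsilon\beta_1,\ \alpha_1\varepsilon,\ \varepsilon^n\rangle . \] Let $R_A$ be the ADR algebra of $A$ and let $M=P_{3,3}/L_{3,3}$ be the $R_A$-module obtained as the quotient of $P_{3,3}$ by its simple submodule $L_{3,3}$. Let $\cdots\to P_2(M)\to P_1(M)\to P_0(M)\to M\to 0$ be a minimal projective resolution of $M$ over $R_A$. Then the descending Loewy length condition fails for the $R_A$-module $M$ when $n\geq 5$. Indeed, $\operatorname{LL}(P_1(M))\leq 6$ and $\operatorname{LL}(P_2(M))\geq 1+n$, so $\operatorname{LL}(P_2(M))\geq\operatorname{LL}(P_1(M))$ for $n\geq5$.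
   Context: All modules are finitely generated left modules; $\operatorname{LL}$ denotes Loewy length. Paths are composed from right to left (e.g. $\alpha_2\alpha_1$ is first $\alpha_1$, then $\alpha_2$), and $P_i=Ae_i$ denotes the projective indecomposable $A$-module at vertex $i$, with simple top $L_i$ and Loewy length $l_i$. Thus $P_3$ is uniserial with composition factors $L_3,L_2,L_3$ from top to socle, and $P_2$ has top $L_2$, middle layer $L_1\oplus L_3$ and socle $L_2$. The ADR algebra of $A$ is $R_A=\operatorname{End}_A(G)^{op}$ where $G=\bigoplus_{i=1}^3\bigoplus_{j=1}^{l_i}P_i/\operatorname{Rad}^jP_i$. Its projective indecomposable modules are $P_{i,j}=\operatorname{Hom}_A(G,P_i/\operatorname{Rad}^jP_i)$ for $1\leq i\leq3$, $1\leq j\leq l_i$; $L_{i,j}$ denotes the simple top of $P_{i,j}$. Since $L_3$ is in the socle of $P_3$ and $l_3=3$, the module $P_{3,3}=\operatorname{Hom}_A(G,P_3)$ contains $\operatorname{Hom}_A(G,L_3)$, which has simple socle $L_{3,3}$; this is the submodule $L_{3,3}\subseteq P_{3,3}$ used to define $M$. An Artin algebra $B$ satisfies the descending Loewy length (DLL) condition if for every $B$-module $M$ a minimal projective resolution $\cdots\to P_i(M)\to\cdots\to P_0(M)\to M\to0$ satisfies $\operatorname{LL}(P_{i+1}(M))<\operatorname{LL}(P_i(M))$ for all $i\geq1$ with $P_i(M)\neq0$. The condition fails for a particular module $M$ if these inequalities do not all hold for $M$. *)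

(* Defs.v *)
From HB Require Import structures.
From mathcomp Require Import all_boot all_order all_algebra.
From mathcomp Require Import boolp.
From mathcomp Require Import finmap.
From mathcomp.multinomials Require Import monalg.

Set Implicit Arguments.
Unset Strict Implicit.
Unset Printing Implicit Defensive.

Import GRing.Theory.
Local Open Scope ring_scope.
Local Open Scope quotient_scope.

Record quiver := Quiver {
  vertex : finType;
  arrow : finType;
  src : arrow -> vertex;
  tgt : arrow -> vertex }.

Section Paths.
Variable Q : quiver.

(* The arrows of a path are listed in the order in which they are traversed. *)
Fixpoint walk (v : vertex Q) (s : seq (arrow Q)) : bool :=
  if s is a :: s' then (src a == v) && walk (tgt a) s' else true.

Record qpath := QPath {
  path_data : vertex Q * seq (arrow Q);
  _ : walk path_data.1 path_data.2 }.

HB.instance Definition _ := [isSub for path_data].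
HB.instance Definition _ := [Choice of qpath by <:].

Definition path_src (p : qpath) : vertex Q := (path_data p).1.
Definition path_tgt (p : qpath) : vertex Q :=
  last (path_data p).1 (map (@tgt Q) (path_data p).2).

Definition trivial_path (v : vertex Q) : qpath := @QPath (v, [::]) isT.

Lemma arrow_path_subproof (a : arrow Q) : walk (src a) [:: a].
Proof. by rewrite /= eqxx. Qed.

Definition arrow_path (a : arrow Q) : qpath :=
  @QPath (src a, [:: a]) (arrow_path_subproof a).

(* [path_comp p q] is first q, then p; it is [None] unless q ends where p
   starts ([insub] then never fails, see [path_compE]). *)
Definition path_comp (p q : qpath) : option qpath :=
  if path_tgt q == path_src p
  then insub (path_src q, (path_data q).2 ++ (path_data p).2) else None.

Lemma walk_cat v s t :
  walk v (s ++ t) = walk v s && walk (last v (map (@tgt Q) s)) t.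
Proof. by elim: s v => //= a s IHs v; rewrite IHs andbA. Qed.

Lemma path_compE p q : path_tgt q = path_src p ->
  omap path_data (path_comp p q) =
    Some (path_src q, (path_data q).2 ++ (path_data p).2).
Proof.
move=> e; rewrite /path_comp e eqxx.
case: insubP => [u _ <-//|]; rewrite /= walk_cat.
rewrite /path_tgt in e; rewrite /path_src e.
by case: p q {e} => [p hp] [q hq] /=; rewrite hp hq.
Qed.

Lemma path_comp_None p q : path_tgt q != path_src p -> path_comp p q = None.
Proof. by rewrite /path_comp => /negPf->. Qed.

Lemma omap_path_data_inj : injective (omap path_data).
Proof. by case=> [x|] [y|] //= [] /val_inj ->. Qed.

Lemma path_comp_src p q r : path_comp p q = Some r -> path_src r = path_src q.
Proof.
rewrite /path_comp; case: ifP => // _; case: insubP => // u _ e [<-].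
by rewrite /path_src [path_data u]e.
Qed.

Lemma path_comp_tgt p q r : path_comp p q = Some r -> path_tgt r = path_tgt p.
Proof.
rewrite /path_comp; case: eqP => // e1; case: insubP => // u _ e [<-].
by rewrite /path_tgt [path_data u]e /= map_cat last_cat -/(path_tgt q) e1.
Qed.

Lemma path_comp_arrows p q r : path_comp p q = Some r ->
  (path_data r).2 = (path_data q).2 ++ (path_data p).2.
Proof.
rewrite /path_comp; case: ifP => // _; case: insubP => // u _ e [<-].
by rewrite [path_data u]e.
Qed.

Lemma path_comp_tgt_src p q r : path_comp p q = Some r ->
  path_tgt q = path_src p.
Proof. by rewrite /path_comp; case: eqP. Qed.

Lemma path_compA p q r :
  obind (path_comp p) (path_comp q r) =
  obind (fun s => path_comp s r) (path_comp p q).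
Proof.
case eqr: (path_comp q r) => [s|]; case epq: (path_comp p q) => [t|] //=.
- have h1 : path_tgt s = path_src p.
    by rewrite (path_comp_tgt eqr) (path_comp_tgt_src epq).
  have h2 : path_tgt r = path_src t.
    by rewrite (path_comp_src epq) (path_comp_tgt_src eqr).
  apply: omap_path_data_inj; rewrite !path_compE //.
  rewrite (path_comp_src eqr) (path_comp_arrows eqr) (path_comp_arrows epq).
  by rewrite catA.
- apply: path_comp_None; apply/eqP => e.
  have := @path_compE p q; rewrite epq -(path_comp_tgt eqr).
  by move/(_ e).
- apply/esym/path_comp_None; apply/eqP => e.
  have := @path_compE q r; rewrite eqr -(path_comp_src epq).
  by move/(_ e).
Qed.

Lemma path_comp1p p : path_comp (trivial_path (path_tgt p)) p = Some p.
Proof.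
apply: omap_path_data_inj; rewrite path_compE //= cats0.
by case: p => -[].
Qed.

Lemma path_compp1 p : path_comp p (trivial_path (path_src p)) = Some p.
Proof.
apply: omap_path_data_inj; rewrite path_compE //=.
by case: p => -[].
Qed.

End Paths.

Definition path_alg (K : fieldType) (Q : quiver) : Type := {malg K[qpath Q]}.

HB.instance Definition _ (K : fieldType) (Q : quiver) :=
  GRing.Lmodule.copy (path_alg K Q) {malg K[qpath Q]}.

HB.lock Definition path_elt (K : fieldType) (Q : quiver) (p : qpath Q) :
  path_alg K Q := << p >>.
Arguments path_elt {K Q} p.

HB.lock Definition path_mul (K : fieldType) (Q : quiver) (x y : path_alg K Q) :
    path_alg K Q :=
  \sum_(p <- msupp x) \sum_(q <- msupp y)
    (x@_p * y@_q) *: oapp path_elt 0 (path_comp p q).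

Section PathAlgebra.
Variables (K : fieldType) (Q : quiver).
Local Notation path_elt := (@path_elt K Q).
Local Notation path_mul := (@path_mul K Q).

Definition path_one : path_alg K Q := \sum_(v : vertex Q) path_elt (trivial_path v).

Lemma path_coefD (x y : path_alg K Q) p : (x + y)@_p = x@_p + y@_p.
Proof. exact: mcoeffD. Qed.

Lemma path_coefZ a (x : path_alg K Q) p : (a *: x)@_p = a * x@_p.
Proof. exact: fgscaleE. Qed.

Lemma path_coef_elt p q : (path_elt p)@_q = (p == q)%:R.
Proof. by rewrite path_elt.unlock; exact: mcoeffU. Qed.

Lemma path_algE (x : path_alg K Q) :
  x = \sum_(p <- msupp x) x@_p *: path_elt p.
Proof.
rewrite {1}[x]monalgE; apply: eq_bigr => p _.
apply/malgP => q; apply: (etrans (mcoeffU _ _ _)).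
by apply/esym; apply: (etrans (path_coefZ _ _ _)); rewrite path_coef_elt mulr_natr.
Qed.

Definition lin_ext (V : lmodType K) (h : qpath Q -> V) (x : path_alg K Q) : V :=
  \sum_(p <- msupp x) x@_p *: h p.

Lemma lin_extEw (V : lmodType K) (h : qpath Q -> V) (x : path_alg K Q)
    (d : {fset qpath Q}) :
  (msupp x `<=` d)%fset -> lin_ext h x = \sum_(p <- d) x@_p *: h p.
Proof.
move=> sd; rewrite /lin_ext; apply/esym.
have -> : \sum_(p <- d) x@_p *: h p
        = \sum_(p <- d | p \in msupp x) x@_p *: h p.
  rewrite [LHS](bigID (fun p => p \in msupp x)) /= [X in _ + X]big1 ?addr0 //.
  by move=> p /mcoeff_outdom ->; rewrite scale0r.
rewrite -big_filter; apply: perm_big; apply: uniq_perm.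
- by rewrite filter_uniq ?fset_uniq.
- exact: fset_uniq.
by move=> p; rewrite mem_filter andb_idr // => /(fsubsetP sd).
Qed.

Lemma lin_ext_linear (V : lmodType K) (h : qpath Q -> V) : linear (lin_ext h).
Proof.
move=> a x y.
pose d := (msupp x `|` msupp y `|` msupp (a *: x + y))%fset.
have s1 : (msupp x `<=` d)%fset.
  by apply/fsubsetP => p; rewrite !inE => ->.
have s2 : (msupp y `<=` d)%fset.
  by apply/fsubsetP => p; rewrite !inE => ->; rewrite orbT.
have s3 : (msupp (a *: x + y) `<=` d)%fset.
  by apply/fsubsetP => p; rewrite !inE => ->; rewrite orbT.
rewrite (lin_extEw h s1) (lin_extEw h s2) (lin_extEw h s3).
rewrite scaler_sumr -big_split /=; apply: eq_bigr => p _.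
have -> : (a *: x + y)@_p = a * x@_p + y@_p.
  by rewrite path_coefD path_coefZ.
by rewrite scalerDl scalerA.
Qed.

HB.instance Definition _ (V : lmodType K) (h : qpath Q -> V) :=
  GRing.isLinear.Build K (path_alg K Q) V _ (lin_ext h) (lin_ext_linear h).

Lemma lin_ext_elt (V : lmodType K) (h : qpath Q -> V) p :
  lin_ext h (path_elt p) = h p.
Proof.
have e : msupp (path_elt p) = [fset p]%fset.
  by rewrite path_elt.unlock msuppU oner_eq0.
rewrite /lin_ext e big_seq_fset1 path_coef_elt eqxx.
exact: scale1r.
Qed.

Definition basis_mul (p q : qpath Q) : path_alg K Q :=
  oapp path_elt 0 (path_comp p q).

Lemma path_mulE x y :
  path_mul x y = lin_ext (fun p => lin_ext (basis_mul p) y) x.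
Proof.
rewrite path_mul.unlock; apply: eq_bigr => p _; rewrite /lin_ext scaler_sumr.
by apply: eq_bigr => q _; rewrite scalerA.
Qed.

Lemma path_mull y : linear (path_mul^~ y).
Proof. by move=> a x z; rewrite !path_mulE linearP. Qed.

Lemma path_mulr x : linear (path_mul x).
Proof.
move=> a y z; rewrite !path_mulE /lin_ext scaler_sumr -big_split /=.
apply: eq_bigr => p _.
rewrite -!/(lin_ext (basis_mul p) _) (lin_ext_linear (basis_mul p)).
by rewrite scalerDr !scalerA [a * _]mulrC.
Qed.

Lemma path_mul_elt p q : path_mul (path_elt p) (path_elt q) = basis_mul p q.
Proof. by rewrite path_mulE !lin_ext_elt. Qed.

Lemma path_mul0 x : path_mul x 0 = 0.
Proof.
by rewrite path_mulE /lin_ext big1 // => p _; rewrite msupp0 big_nil scaler0.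
Qed.

Lemma path_0mul x : path_mul 0 x = 0.
Proof. by rewrite path_mulE linear0. Qed.

Lemma path_sum_ind (T : path_alg K Q -> Prop) : T 0 ->
  (forall a x y, T x -> T y -> T (a *: x + y)) -> (forall p, T (path_elt p)) ->
  forall x, T x.
Proof.
move=> T0 TL Te x; rewrite [x]path_algE.
by elim/big_rec: _ => // p y _ Ty; exact: TL.
Qed.

Lemma path_mulA : associative path_mul.
Proof.
move=> x y z; elim/path_sum_ind: x => [|a x x' IH IH'|p].
- by rewrite !path_0mul.
- by rewrite !path_mull IH IH'.
elim/path_sum_ind: y => [|a y y' IH IH'|q].
- by rewrite path_0mul !path_mul0 path_0mul.
- by rewrite !(path_mull, path_mulr) IH IH'.
elim/path_sum_ind: z => [|a z z' IH IH'|r].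
- by rewrite !path_mul0.
- by rewrite !path_mulr IH IH'.
have := path_compA p q r; rewrite !path_mul_elt /basis_mul.
case: (path_comp q r) => [s|]; case: (path_comp p q) => [t|] //=.
- by move=> e; rewrite !path_mul_elt /basis_mul e.
- by move=> e; rewrite path_mul_elt /basis_mul e path_0mul.
- by move=> e; rewrite path_mul_elt /basis_mul -e path_mul0.
by rewrite path_mul0 path_0mul.
Qed.

Lemma path_mul_suml I (s : seq I) (F : I -> path_alg K Q) y :
  path_mul (\sum_(i <- s) F i) y = \sum_(i <- s) path_mul (F i) y.
Proof.
elim: s => [|i s IHs]; first by rewrite !big_nil path_0mul.
by rewrite !big_cons -IHs -[F i]scale1r path_mull !scale1r.
Qed.

Lemma path_mul_sumr I (s : seq I) (F : I -> path_alg K Q) y :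
  path_mul y (\sum_(i <- s) F i) = \sum_(i <- s) path_mul y (F i).
Proof.
elim: s => [|i s IHs]; first by rewrite !big_nil path_mul0.
by rewrite !big_cons -IHs -[F i]scale1r path_mulr !scale1r.
Qed.

Lemma path_mul1 : left_id path_one path_mul.
Proof.
elim/path_sum_ind => [|a x y IH IH'|p].
- exact: path_mul0.
- by rewrite path_mulr IH IH'.
rewrite path_mul_suml (bigD1 (path_tgt p)) //= path_mul_elt /basis_mul.
rewrite path_comp1p /= big1 ?addr0 // => v /eqP ne.
rewrite path_mul_elt /basis_mul path_comp_None //.
by apply/eqP => e; apply: ne.
Qed.

Lemma path_mulr1 : right_id path_one path_mul.
Proof.
elim/path_sum_ind => [|a x y IH IH'|p].
- exact: path_0mul.
- by rewrite path_mull IH IH'.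
rewrite path_mul_sumr (bigD1 (path_src p)) //= path_mul_elt /basis_mul.
rewrite path_compp1 /= big1 ?addr0 // => v /eqP ne.
rewrite path_mul_elt /basis_mul path_comp_None //.
by apply/eqP => e; apply: ne.
Qed.

Lemma path_mulDl : left_distributive path_mul +%R.
Proof. by move=> x y z; rewrite -[x]scale1r path_mull !scale1r. Qed.

Lemma path_mulDr : right_distributive path_mul +%R.
Proof. by move=> x y z; rewrite -[y]scale1r path_mulr !scale1r. Qed.

HB.instance Definition _ := GRing.Zmodule_isPzRing.Build (path_alg K Q)
  path_mulA path_mul1 path_mulr1 path_mulDl path_mulDr.

End PathAlgebra.

Definition two_sided (R : pzRingType) (I : {pred R}) : Prop :=
  forall a x : R, x \in I -> (a * x \in I) /\ (x * a \in I).

HB.mixin Record isTwoSided (R : pzRingType) (I : R -> bool) := {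
  two_sided_subproof : two_sided I }.

#[short(type="ideal2")]
HB.structure Definition Ideal2 (R : pzRingType) :=
  {I of GRing.ZmodClosed R I & isTwoSided R I}.

Section RingQuotient.
Variables (R : pzRingType) (I : ideal2 R).

Definition quot_ring : Type := {ideal_quot I}.

HB.instance Definition _ := GRing.Zmodule.copy quot_ring {ideal_quot I}.

Definition quot_proj (x : R) : quot_ring := \pi_({ideal_quot I}) x.

Definition quot_mul (x y : quot_ring) : quot_ring := quot_proj (repr x * repr y).

Lemma quot_projP (x y : R) : quot_proj x = quot_proj y <-> x - y \in I.
Proof. by rewrite Quotient.idealrBE; split=> /eqP. Qed.

Lemma quot_reprK (x : quot_ring) : quot_proj (repr x) = x.
Proof. exact: reprK. Qed.

Lemma quot_projD (x y : R) : quot_proj (x + y) = quot_proj x + quot_proj y.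
Proof. exact: (raddfD \pi_({ideal_quot I})). Qed.

Lemma quot_projM (x y : R) : quot_proj (x * y) = quot_mul (quot_proj x) (quot_proj y).
Proof.
apply/quot_projP.
set x' := repr _; set y' := repr _.
have hx : x - x' \in I by apply/quot_projP; rewrite quot_reprK.
have hy : y - y' \in I by apply/quot_projP; rewrite quot_reprK.
have -> : x * y - x' * y' = x * (y - y') + (x - x') * y'.
  by rewrite mulrBr mulrBl addrA subrK.
by rewrite rpredD //; [case: (two_sided_subproof (s := I) x _ hy) | case: (two_sided_subproof (s := I) y' _ hx)].
Qed.

Lemma quot_ind (T : quot_ring -> Prop) : (forall x, T (quot_proj x)) -> forall x, T x.
Proof. by move=> h x; rewrite -(quot_reprK x). Qed.

Lemma quot_mulA : associative quot_mul.
Proof.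
by elim/quot_ind=> x; elim/quot_ind=> y; elim/quot_ind=> z; rewrite -!quot_projM mulrA.
Qed.
Lemma quot_mul1 : left_id (quot_proj 1) quot_mul.
Proof. by elim/quot_ind=> x; rewrite -!quot_projM mul1r. Qed.
Lemma quot_mulr1 : right_id (quot_proj 1) quot_mul.
Proof. by elim/quot_ind=> x; rewrite -!quot_projM mulr1. Qed.
Lemma quot_mulDl : left_distributive quot_mul +%R.
Proof.
elim/quot_ind=> x; elim/quot_ind=> y; elim/quot_ind=> z.
by rewrite -quot_projD -!quot_projM mulrDl quot_projD.
Qed.
Lemma quot_mulDr : right_distributive quot_mul +%R.
Proof.
elim/quot_ind=> x; elim/quot_ind=> y; elim/quot_ind=> z.
by rewrite -quot_projD -!quot_projM mulrDr quot_projD.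
Qed.

HB.instance Definition _ := GRing.Zmodule_isPzRing.Build quot_ring
  quot_mulA quot_mul1 quot_mulr1 quot_mulDl quot_mulDr.

End RingQuotient.

Definition ideal_gen (R : pzRingType) (S : seq R) : {pred R} :=
  fun x => `[< forall J : ideal2 R, {subset S <= J} -> x \in J >].

Section IdealGen.
Variables (R : pzRingType) (S : seq R).

Lemma ideal_gen_zmod : zmod_closed (ideal_gen S).
Proof.
split=> [|x y /asboolP hx /asboolP hy]; apply/asboolP => J hJ.
  exact: rpred0.
by apply: rpredB; [apply: hx|apply: hy].
Qed.

HB.instance Definition _ :=
  GRing.isZmodClosed.Build R (ideal_gen S) ideal_gen_zmod.

Lemma ideal_gen_two_sided : two_sided (ideal_gen S).
Proof.
move=> a x /asboolP hx; split; apply/asboolP => J hJ;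
by case: (two_sided_subproof (s := J) a _ (hx J hJ)).
Qed.

HB.instance Definition _ :=
  isTwoSided.Build R (ideal_gen S) ideal_gen_two_sided.

End IdealGen.

Section Modules.
Variable R : pzRingType.
Implicit Types V X Y : lmodType R.

Definition submod V (W : submodClosed V) : Type := {x : V | x \in W}.

HB.instance Definition _ V (W : submodClosed V) := SubChoice.on (submod W).
HB.instance Definition _ V (W : submodClosed V) :=
  [SubChoice_isSubLmodule of submod W by <:].

(* [{ideal_quot _}] wants a [zmodClosed] predicate; a [submodClosed] one is only
   known to be closed under sums and scaling. *)
Definition mod_pred V (W : submodClosed V) : {pred V} := fun x => x \in W.

Lemma mod_pred_zmod V (W : submodClosed V) : zmod_closed (mod_pred W).
Proof. exact: (GRing.subsemimod_closedB (GRing.submodClosedP W)). Qed.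

HB.instance Definition _ V (W : submodClosed V) :=
  GRing.isZmodClosed.Build V (mod_pred W) (mod_pred_zmod W).

Definition mod_zmod V (W : submodClosed V) : zmodClosed V := mod_pred W.

Definition quot_mod V (W : submodClosed V) : Type := {ideal_quot (mod_zmod W)}.

HB.instance Definition _ V (W : submodClosed V) :=
  GRing.Zmodule.copy (quot_mod W) {ideal_quot (mod_zmod W)}.

Section QuotMod.
Variables (V : lmodType R) (W : submodClosed V).

Definition mod_proj (x : V) : quot_mod W := \pi_({ideal_quot (mod_zmod W)}) x.

Definition quot_scale (a : R) (x : quot_mod W) : quot_mod W :=
  mod_proj (a *: repr x).

Lemma mod_projP (x y : V) : mod_proj x = mod_proj y <-> x - y \in W.
Proof. by rewrite -[_ \in W]/(_ \in mod_pred W) Quotient.idealrBE; split=> /eqP. Qed.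

Lemma mod_reprK (x : quot_mod W) : mod_proj (repr x) = x.
Proof. exact: reprK. Qed.

Lemma mod_projD (x y : V) : mod_proj (x + y) = mod_proj x + mod_proj y.
Proof. exact: (raddfD \pi_({ideal_quot (mod_zmod W)})). Qed.

Lemma mod_projZ a (x : V) : mod_proj (a *: x) = quot_scale a (mod_proj x).
Proof.
apply/mod_projP; rewrite -scalerBr rpredZ //.
by apply/mod_projP; rewrite mod_reprK.
Qed.

Lemma mod_ind (T : quot_mod W -> Prop) : (forall x, T (mod_proj x)) -> forall x, T x.
Proof. by move=> h x; rewrite -(mod_reprK x). Qed.

Lemma quot_scaleA a b x : quot_scale a (quot_scale b x) = quot_scale (a * b) x.
Proof. by elim/mod_ind: x => x; rewrite -!mod_projZ scalerA. Qed.
Lemma quot_scale1 : left_id 1 quot_scale.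
Proof. by elim/mod_ind=> x; rewrite -!mod_projZ scale1r. Qed.
Lemma quot_scaleDr : right_distributive quot_scale +%R.
Proof.
move=> a; elim/mod_ind=> x; elim/mod_ind=> y.
by rewrite -mod_projD -!mod_projZ scalerDr mod_projD.
Qed.
Lemma quot_scaleDl x : {morph quot_scale^~ x : a b / a + b}.
Proof.
by move=> a b; elim/mod_ind: x => x; rewrite -!mod_projZ scalerDl mod_projD.
Qed.

HB.instance Definition _ := GRing.Zmodule_isLmodule.Build R (quot_mod W)
  quot_scaleA quot_scale1 quot_scaleDr quot_scaleDl.

Lemma mod_proj_linear : linear mod_proj.
Proof. by move=> a x y; rewrite mod_projD mod_projZ. Qed.

HB.instance Definition _ :=
  GRing.isLinear.Build R V (quot_mod W) _ mod_proj mod_proj_linear.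

End QuotMod.

Definition full_mod V : {pred V} := xpredT.

Lemma full_closed V : GRing.submod_closed (@full_mod V).
Proof. by split. Qed.

HB.instance Definition _ V :=
  GRing.isSubmodClosed.Build R V (@full_mod V) (full_closed V).

Definition maximal_in V (N W : submodClosed V) : Prop :=
  [/\ {subset N <= W}, ~ {subset W <= N} &
      forall L : submodClosed V, {subset N <= L} -> {subset L <= W} ->
        {subset L <= N} \/ {subset W <= L}].

Definition simple_submod V (S : submodClosed V) : Prop :=
  (exists2 x, x \in S & x != 0) /\
  forall L : submodClosed V, {subset L <= S} ->
    (forall x, x \in L -> x = 0) \/ {subset S <= L}.

Definition rad_pred V (W : submodClosed V) : {pred V} :=
  fun x => (x \in W) &&
    `[< forall N : submodClosed V, maximal_in N W -> x \in N >].

(* The sum of the simple submodules of W, as the least submodule containing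
   all of them. *)
Definition soc_pred V (W : submodClosed V) : {pred V} :=
  fun x => `[< forall N : submodClosed V,
    (forall S : submodClosed V, simple_submod S -> {subset S <= W} ->
      {subset S <= N}) -> x \in N >].

Lemma rad_closed V (W : submodClosed V) : GRing.submod_closed (rad_pred W).
Proof.
split=> [|a x y /andP[xW /asboolP hx] /andP[yW /asboolP hy]]; apply/andP; split.
- exact: rpred0.
- by apply/asboolP => N _; exact: rpred0.
- by rewrite rpredD ?rpredZ.
by apply/asboolP => N hN; rewrite rpredD ?rpredZ ?hx ?hy.
Qed.

HB.instance Definition _ V (W : submodClosed V) :=
  GRing.isSubmodClosed.Build R V (rad_pred W) (rad_closed W).

Lemma soc_closed V (W : submodClosed V) : GRing.submod_closed (soc_pred W).
Proof.
split=> [|a x y /asboolP hx /asboolP hy]; apply/asboolP => N hN.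
  exact: rpred0.
by rewrite rpredD ?rpredZ ?hx ?hy.
Qed.

HB.instance Definition _ V (W : submodClosed V) :=
  GRing.isSubmodClosed.Build R V (soc_pred W) (soc_closed W).

Definition rad V (W : submodClosed V) : submodClosed V := rad_pred W.
Definition soc V (W : submodClosed V) : submodClosed V := soc_pred W.

Definition rad_pow V (j : nat) : submodClosed V := iter j (@rad V) (@full_mod V).

Definition rad_vanishes V : pred nat :=
  fun j => `[< forall x : V, x \in rad_pow V j -> x = 0 >].

(* The least j with Rad^j V = 0; the default value 0 is taken only if there is
   no such j, which does not happen for f.g. modules over an Artin algebra. *)
Definition LL V : nat :=
  if pselect (exists j, rad_vanishes V j) is left ex then ex_minn ex else 0%N.

Definition dsum (T : finType) (X : T -> lmodType R) : Type := forall t, X t.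

Section DirectSum.
Variables (T : finType) (X : T -> lmodType R).

HB.instance Definition _ := Choice.copy (dsum X) (forall t, X t).

Implicit Types f g h : dsum X.

Definition dsum_zero : dsum X := fun t => 0.
Definition dsum_opp f : dsum X := fun t => - f t.
Definition dsum_add f g : dsum X := fun t => f t + g t.
Definition dsum_scale a f : dsum X := fun t => a *: f t.

Lemma dsum_addA : associative dsum_add.
Proof. by move=> f g h; apply: functional_extensionality_dep => t; exact: addrA. Qed.
Lemma dsum_addC : commutative dsum_add.
Proof. by move=> f g; apply: functional_extensionality_dep => t; exact: addrC. Qed.
Lemma dsum_add0 : left_id dsum_zero dsum_add.
Proof. by move=> f; apply: functional_extensionality_dep => t; exact: add0r. Qed.
Lemma dsum_addN : left_inverse dsum_zero dsum_opp dsum_add.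
Proof. by move=> f; apply: functional_extensionality_dep => t; exact: addNr. Qed.

HB.instance Definition _ := GRing.isZmodule.Build (dsum X)
  dsum_addA dsum_addC dsum_add0 dsum_addN.

Lemma dsum_scaleA a b f : dsum_scale a (dsum_scale b f) = dsum_scale (a * b) f.
Proof. by apply: functional_extensionality_dep => t; exact: scalerA. Qed.
Lemma dsum_scale1 : left_id 1 dsum_scale.
Proof. by move=> f; apply: functional_extensionality_dep => t; exact: scale1r. Qed.
Lemma dsum_scaleDr : right_distributive dsum_scale +%R.
Proof. by move=> a f g; apply: functional_extensionality_dep => t; exact: scalerDr. Qed.
Lemma dsum_scaleDl f : {morph dsum_scale^~ f : a b / a + b}.
Proof. by move=> a b; apply: functional_extensionality_dep => t; exact: scalerDl. Qed.

HB.instance Definition _ := GRing.Zmodule_isLmodule.Build R (dsum X)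
  dsum_scaleA dsum_scale1 dsum_scaleDr dsum_scaleDl.

End DirectSum.

Definition fin_gen V : Prop :=
  exists (m : nat) (g : 'I_m -> V),
    forall x : V, exists c : 'I_m -> R, x = \sum_(i < m) c i *: g i.

Definition projective V : Prop :=
  forall (X Y : lmodType R) (g : {linear X -> Y}) (f : {linear V -> Y}),
    (forall y, exists x, g x = y) ->
    exists h : {linear V -> X}, forall v, g (h v) = f v.

Definition superfluous V (N : {pred V}) : Prop :=
  forall L : submodClosed V,
    (forall v, exists x y, [/\ x \in N, y \in L & v = x + y]) ->
    forall v, v \in L.

Definition ker_pred V Y (f : {linear V -> Y}) : {pred V} := fun v => f v == 0.

Definition exact_at X V Y (f : {linear X -> V}) (g : {linear V -> Y}) : Prop :=
  forall v, g v = 0 <-> exists x, f x = v.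

(* Superfluity of the kernels makes [aug] a projective cover of V and each
   [d i] a projective cover of its image, i.e. of the kernel of the next map. *)
Record min_proj_res V (P : nat -> lmodType R)
    (d : forall i, {linear P i.+1 -> P i}) (aug : {linear P 0%N -> V}) : Prop := {
  res_fin_gen : forall i, fin_gen (P i);
  res_projective : forall i, projective (P i);
  res_surj : forall v, exists x, aug x = v;
  res_exact0 : exact_at (d 0%N) aug;
  res_exact : forall i, exact_at (d i.+1) (d i);
  res_min0 : superfluous (ker_pred aug);
  res_min : forall i, superfluous (ker_pred (d i)) }.

(* The inequalities that the DLL condition asks of a minimal projective
   resolution P of each module. *)
Definition descending_LL (P : nat -> lmodType R) : Prop :=
  forall i, (1 <= i)%N -> (exists x : P i, x != 0) ->
    (LL (P i.+1) < LL (P i))%N.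

End Modules.

Definition hom (A : pzRingType) (G X : lmodType A) : Type := {linear G -> X}.

Section Hom.
Variables (A : pzRingType) (G X : lmodType A).

HB.instance Definition _ := gen_eqMixin (hom G X).
HB.instance Definition _ := gen_choiceMixin (hom G X).

Definition hom_fun (f : hom G X) : G -> X := (f : {linear G -> X}).
Coercion hom_fun : hom >-> Funclass.
HB.instance Definition _ (f : hom G X) :=
  GRing.Linear.copy (hom_fun f) (f : {linear G -> X}).

Lemma homP (f g : hom G X) : f =1 g -> f = g.
Proof.
move=> /funext; case: f g => [f [[f1] [f2]]] [g [[g1] [g2]]].
rewrite /hom_fun /= => e; case: g / e g1 g2 => g1 g2.
by rewrite (Prop_irrelevance f1 g1) (Prop_irrelevance f2 g2).
Qed.

Definition hom_zero : hom G X := (\0 : {linear G -> X}).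
Definition hom_opp (f : hom G X) : hom G X := (\- hom_fun f : {linear G -> X}).
Definition hom_add (f g : hom G X) : hom G X :=
  (hom_fun f \+ hom_fun g : {linear G -> X}).

Lemma hom_addA : associative hom_add.
Proof. by move=> f g h; apply: homP => x; exact: addrA. Qed.
Lemma hom_addC : commutative hom_add.
Proof. by move=> f g; apply: homP => x; exact: addrC. Qed.
Lemma hom_add0 : left_id hom_zero hom_add.
Proof. by move=> f; apply: homP => x; exact: add0r. Qed.
Lemma hom_addN : left_inverse hom_zero hom_opp hom_add.
Proof. by move=> f; apply: homP => x; exact: addNr. Qed.

HB.instance Definition _ := GRing.isZmodule.Build (hom G X)
  hom_addA hom_addC hom_add0 hom_addN.

End Hom.

Definition hom_comp (A : pzRingType) (U V W : lmodType A)
    (g : hom V W) (f : hom U V) : hom U W :=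
  (hom_fun g \o hom_fun f : {linear U -> W}).

Definition endo (A : pzRingType) (G : lmodType A) : Type := hom G G.

Section Endo.
Variables (A : pzRingType) (G : lmodType A).

HB.instance Definition _ := GRing.Zmodule.copy (endo G) (hom G G).

Definition endo_one : endo G := (idfun : {linear G -> G}).
Definition endo_mul (g f : endo G) : endo G := hom_comp g f.

Lemma endo_mulA : associative endo_mul.
Proof. by move=> f g h; apply: homP. Qed.
Lemma endo_mul1 : left_id endo_one endo_mul.
Proof. by move=> f; apply: homP. Qed.
Lemma endo_mulr1 : right_id endo_one endo_mul.
Proof. by move=> f; apply: homP. Qed.
Lemma endo_mulDl : left_distributive endo_mul +%R.
Proof. by move=> f g h; apply: homP. Qed.
Lemma endo_mulDr : right_distributive endo_mul +%R.
Proof. by move=> f g h; apply: homP => x; exact: (raddfD (hom_fun f)). Qed.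

HB.instance Definition _ := GRing.Zmodule_isPzRing.Build (endo G)
  endo_mulA endo_mul1 endo_mulr1 endo_mulDl endo_mulDr.

Definition hom_scale (X : lmodType A) (r : (endo G)^c) (f : hom G X) : hom G X :=
  hom_comp f (r : endo G).

Variable X : lmodType A.

Lemma hom_scaleA r s (f : hom G X) :
  hom_scale r (hom_scale s f) = hom_scale (r * s) f.
Proof. by apply: homP. Qed.
Lemma hom_scale1 : left_id 1 (@hom_scale X).
Proof. by move=> f; apply: homP. Qed.
Lemma hom_scaleDr : right_distributive (@hom_scale X) +%R.
Proof. by move=> r f g; apply: homP. Qed.
Lemma hom_scaleDl (f : hom G X) : {morph (@hom_scale X)^~ f : r s / r + s}.
Proof. by move=> r s; apply: homP => x; exact: (raddfD (hom_fun f)). Qed.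

HB.instance Definition _ := GRing.Zmodule_isLmodule.Build (endo G)^c (hom G X)
  hom_scaleA hom_scale1 hom_scaleDr hom_scaleDl.

Definition hom_in_pred (W : submodClosed X) : {pred (hom G X)} :=
  fun f => `[< forall g, f g \in W >].

Lemma hom_in_closed (W : submodClosed X) : GRing.submod_closed (hom_in_pred W).
Proof.
split=> [|r f h /asboolP hf /asboolP hh]; apply/asboolP => g.
  exact: rpred0.
by apply: (rpredD (hf _) (hh _)).
Qed.

HB.instance Definition _ (W : submodClosed X) :=
  GRing.isSubmodClosed.Build (endo G)^c (hom G X) (hom_in_pred W)
    (hom_in_closed W).

Definition hom_in (W : submodClosed X) : submodClosed (hom G X) := hom_in_pred W.

End Endo.

Section ADR.
Variables (A : pzRingType) (I : finType) (e : I -> A).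

Definition Ae_pred (i : I) : {pred A^o} := fun x => `[< exists a : A, x = a * e i >].

Lemma Ae_closed i : GRing.submod_closed (Ae_pred i).
Proof.
split=> [|a x y /asboolP[b ->] /asboolP[c ->]]; apply/asboolP.
  by exists 0; rewrite mul0r.
by exists (a * b + c); rewrite mulrDl -mulrA.
Qed.

HB.instance Definition _ i :=
  GRing.isSubmodClosed.Build A A^o (Ae_pred i) (Ae_closed i).

Definition proj_indec (i : I) : lmodType A := submod (Ae_pred i).

Definition trunc (i : I) (j : nat) : lmodType A :=
  quot_mod (rad_pow (proj_indec i) j).

(* Pairs (i, j) with 0 <= j < l_i; the pair (i, j) stands for P_i/Rad^(j+1) P_i. *)
Definition ADR_index : finType := {i : I & 'I_(LL (proj_indec i))}.

Definition ADR_gen : lmodType A :=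
  dsum (fun t : ADR_index => trunc (tag t) (tagged t).+1).

Definition ADR : pzRingType := (endo ADR_gen)^c.

Definition ADR_proj (i : I) (j : nat) : lmodType ADR := hom ADR_gen (trunc i j).

End ADR.

Inductive Qvertex := V1 | V2 | V3.
Inductive Qarrow := Eps | Alpha1 | Beta1 | Alpha2 | Beta2.

Definition Qvertex_code (v : Qvertex) : 'I_3 :=
  match v with V1 => inord 0 | V2 => inord 1 | V3 => inord 2 end.
Definition Qvertex_decode (i : 'I_3) : Qvertex :=
  match val i with 0 => V1 | 1 => V2 | _ => V3 end.
Lemma Qvertex_codeK : cancel Qvertex_code Qvertex_decode.
Proof. by case; rewrite /Qvertex_decode /= inordK. Qed.
HB.instance Definition _ := Finite.copy Qvertex (can_type Qvertex_codeK).

Definition Qarrow_code (a : Qarrow) : 'I_5 :=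
  match a with
  | Eps => inord 0 | Alpha1 => inord 1 | Beta1 => inord 2
  | Alpha2 => inord 3 | Beta2 => inord 4
  end.
Definition Qarrow_decode (i : 'I_5) : Qarrow :=
  match val i with
  | 0 => Eps | 1 => Alpha1 | 2 => Beta1 | 3 => Alpha2 | _ => Beta2
  end.
Lemma Qarrow_codeK : cancel Qarrow_code Qarrow_decode.
Proof. by case; rewrite /Qarrow_decode /= inordK. Qed.
HB.instance Definition _ := Finite.copy Qarrow (can_type Qarrow_codeK).

Definition quivQ : quiver := @Quiver Qvertex Qarrow
  (fun a => match a with
            | Eps => V1 | Alpha1 => V1 | Beta1 => V2 | Alpha2 => V2 | Beta2 => V3
            end)
  (fun a => match a with
            | Eps => V1 | Alpha1 => V2 | Beta1 => V1 | Alpha2 => V3 | Beta2 => V2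
            end).

Section Algebra.
Variables (K : fieldType) (n : nat).

Definition arr (a : Qarrow) : path_alg K quivQ := @path_elt K quivQ (@arrow_path quivQ a).

Definition relations : seq (path_alg K quivQ) :=
  [:: arr Alpha2 * arr Alpha1;
      arr Beta1 * arr Beta2;
      arr Beta2 * arr Alpha2 - arr Alpha1 * arr Beta1;
      arr Eps * arr Beta1;
      arr Alpha1 * arr Eps;
      arr Eps ^+ n].

Definition algA : pzRingType := quot_ring (ideal_gen relations).

Definition idem (v : Qvertex) : algA :=
  quot_proj (ideal_gen relations) (@path_elt K quivQ (@trivial_path quivQ v)).

Definition R_A : pzRingType := ADR idem.

(* As l_3 = 3, [trunc idem V3 3] = P_3/Rad^3 P_3 is P_3 up to isomorphism. *)
Definition P33 : lmodType R_A := ADR_proj idem V3 3.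

(* L_3 is realised as the socle of P_3, and L_{3,3} as the socle of
   Hom_A(G, L_3), a submodule of P_{3,3} = Hom_A(G, P_3). *)
Definition L33 : submodClosed P33 :=
  soc (hom_in (ADR_gen idem) (soc (@full_mod _ (trunc idem V3 3)))).

Definition modM : lmodType R_A := quot_mod L33.

End Algebra.

(* Main.v *)
(* P_1(M) is P_{3,3}, which covers L_{3,3} through composition with the
   endomorphism φ : e_3 ↦ α2β2 of P_3, and the kernel of that cover is
   Hom(G, Rad P_3).  Every map from G to Rad P_3 lifts along
   ψ : P_2/Rad^2 P_2 → P_3, e_2 ↦ β2, so that P_2(M) is P_{2,2}.  Now P_{3,3} has
   length 6, while the kernel of P_{2,2} → Hom(G, Rad P_3) is Hom(G, L_1), whose
   n elements P_1/Rad^k P_1 → L_1 (1 <= k <= n) lie in successive radical layers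
   strictly below the top of P_{2,2}.

   Both Loewy length bounds come from one principle.  Upper bounds: if a module
   has ranked K-valued coordinates such that acting by the ring never makes a
   coordinate depend on those of higher rank, and on no other one of the same
   rank, then Rad^k kills the coordinates of rank < k.  Lower bounds: r x lies in
   Rad W as soon as x lies in W and every s r acts nilpotently on x. *)
Require Import Defs.
From HB Require Import structures.
From mathcomp Require Import all_boot all_order all_algebra.
From mathcomp Require Import boolp.
Import Defs.

Set Implicit Arguments.
Unset Strict Implicit.
Unset Printing Implicit Defensive.

Import GRing.Theory.
Local Open Scope ring_scope.

(** * Submodules, radicals and socles *)

(** The statement quantifies over every minimal resolution of M, so its terms are matched with
    explicit modules Hom(G, X) by uniqueness of projective covers, one degree at a time; Loewy
    lengths are then bounded across these isomorphisms. Every computation needs the normal forms to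
    be a basis of A. Spanning follows from the relations; independence is the harder half, because
    the ideal is only given as an intersection of ideals. Coefficient functionals are therefore
    built on the path algebra, and their common kernel is shown to be a two-sided ideal containing
    the relations. The resulting rules are collected in [coordinates], and the later sections work
    with any ring satisfying them. A map from G is studied through the images of the generators of
    the summands of G. R_A acts by precomposition, so modulo shorter paths a coordinate of r f
    involves only the same path on quotients of the same P_i that are no longer; this is the order
    behind the rankings. The constant 6 is 1 + 2 + 3: in P_{3,3} the coordinates at e_3, β2 and α2β2
    survive on one, two and three summands of G respectively. *)

Section Submodules.
Variables (R : pzRingType) (V : lmodType R).

(** The closure proof is an argument of the predicate, so that a single canonical instance turns
    every closed property into a [submodClosed]. *)
Definition sub_pred (P : V -> Prop)
    (_ : P 0 /\ forall a x y, P x -> P y -> P (a *: x + y)) : {pred V} :=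
  fun x => `[< P x >].

Lemma sub_pred_closed P h : GRing.submod_closed (@sub_pred P h).
Proof.
case: h => P0 PL; split=> [|a x y /asboolP Px /asboolP Py]; apply/asboolP => //.
exact: PL.
Qed.

HB.instance Definition _ P h :=
  GRing.isSubmodClosed.Build R V (@sub_pred P h) (sub_pred_closed h).

Definition sub_mod P h : submodClosed V := @sub_pred P h.

Lemma sub_modP P h x : reflect (P x) (x \in @sub_mod P h).
Proof. exact: asboolP. Qed.

Lemma submodB (W : submodClosed V) x y : x \in W -> y \in W -> x - y \in W.
Proof. by move=> xW yW; rewrite -scaleN1r rpredD ?rpredZ. Qed.

Lemma cyclic_closed (x : V) :
  (exists r : R, 0 = r *: x) /\
  forall (a : R) y z, (exists r : R, y = r *: x) -> (exists r : R, z = r *: x) ->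
    exists r : R, a *: y + z = r *: x.
Proof.
split=> [|a y z [r ->] [s ->]]; first by exists 0; rewrite scale0r.
by exists (a * r + s); rewrite scalerDl scalerA.
Qed.

Definition cyclic (x : V) : submodClosed V := sub_mod (cyclic_closed x).

Lemma cyclicP x y : reflect (exists r : R, y = r *: x) (y \in cyclic x).
Proof. exact: asboolP. Qed.

Lemma cyclic_sub (N : submodClosed V) x : x \in N -> {subset cyclic x <= N}.
Proof. by move=> xN _ /cyclicP[r ->]; exact: rpredZ. Qed.

Lemma rad_sub (W : submodClosed V) : {subset rad W <= W}.
Proof. by move=> x /andP[]. Qed.

Lemma rad_pow_anti i j : (i <= j)%N -> {subset rad_pow V j <= rad_pow V i}.
Proof.
move=> /subnK <-; elim: (j - i)%N => [|k IH] x //=.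
by move=> /rad_sub; exact: IH.
Qed.

(** The submodule N + Rx lies in W and is strictly larger than N, so maximality makes it all of
    W. *)
Lemma maximal_split (N W : submodClosed V) x : maximal_in N W ->
  x \in W -> x \notin N ->
  forall v, v \in W -> exists u (s : R), u \in N /\ v = u + s *: x.
Proof.
case=> NW _ maxN xW xN.
have cl : (exists u (s : R), u \in N /\ 0 = u + s *: x) /\
    forall (a : R) y z, (exists u (s : R), u \in N /\ y = u + s *: x) ->
      (exists u (s : R), u \in N /\ z = u + s *: x) ->
      exists u (s : R), u \in N /\ a *: y + z = u + s *: x.
  split=> [|a y z [u [s [uN ->]]] [u' [s' [uN' ->]]]].
    by exists 0, 0; rewrite rpred0 scale0r addr0.
  exists (a *: u + u'), (a * s + s'); split; first by rewrite rpredD ?rpredZ.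
  by rewrite scalerDr scalerA scalerDl addrACA.
have [||LN|WL] := maxN (sub_mod cl).
- by move=> y yN; apply/sub_modP; exists y, 0; rewrite scale0r addr0.
- by move=> y /sub_modP[u [s [uN ->]]]; rewrite rpredD ?rpredZ // NW.
- case/negP: xN; apply: LN; apply/sub_modP.
  by exists 0, 1; rewrite rpred0 scale1r add0r.
by move=> v /WL/sub_modP.
Qed.

(** Modulo [N] the element [x] is fixed by [r], hence by every power of [r], and one of these powers
    kills it. *)
Lemma mem_nilpotent (N : submodClosed V) (r : R) x m :
  x - r *: x \in N -> r ^+ m *: x = 0 -> x \in N.
Proof.
move=> xN rx; rewrite -[x]subr0 -rx; elim: m {rx} => [|m IH].
  by rewrite scale1r subrr rpred0.
have -> : x - r ^+ m.+1 *: x = (x - r ^+ m *: x) + r ^+ m *: (x - r *: x).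
  by rewrite scalerBr scalerA -exprSr addrA subrK.
by rewrite rpredD ?rpredZ.
Qed.

(** If a maximal N missed r x, then x = u + s r x with u in N; so s r would fix x modulo N, and
    nilpotence would put x, hence r x, into N. *)
Lemma nil_mem_rad (W : submodClosed V) (r : R) x : x \in W ->
  (forall s, exists m, (s * r) ^+ m *: x = 0) -> r *: x \in rad W.
Proof.
move=> xW nil; have rxW : r *: x \in W by rewrite rpredZ.
apply/andP; split=> //; apply/asboolP => N maxN; apply: contrapT => /negP rxN.
have [u [s [uN ex]]] := maximal_split maxN rxW rxN xW.
case/negP: (rxN); rewrite rpredZ //; have [m hm] := nil s.
apply: mem_nilpotent hm.
by rewrite {1}ex -scalerA addrK.
Qed.

(* The maximal submodules that cut out the layer k are the kernels, in Rad^k, of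
   the single coordinates of rank k. *)
Lemma rad_pow_filtration (F : fieldType) (sc : F -> R) (I : Type)
    (w : I -> nat) (c : I -> V -> F) :
  (forall i x y, c i (x + y) = c i x + c i y) ->
  (forall i a x, c i (sc a *: x) = a * c i x) ->
  (forall i (r : R) x, (forall j, (w j < w i)%N -> c j x = 0) -> c i x = 0 ->
    c i (r *: x) = 0) ->
  forall k x, x \in rad_pow V k -> forall i, (w i < k)%N -> c i x = 0.
Proof.
move=> cD cZ cR; elim=> // k IH x xk i; rewrite ltnS leq_eqVlt.
have xW := rad_sub xk.
case/orP=> [/eqP wi|]; last exact: IH.
apply: contrapT => cx.
have c0 : c i 0 = 0 by apply: (@addrI _ (c i 0)); rewrite -cD !addr0.
have cl : (0 \in rad_pow V k /\ c i 0 = 0) /\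
    forall (a : R) y z, y \in rad_pow V k /\ c i y = 0 ->
      z \in rad_pow V k /\ c i z = 0 ->
      a *: y + z \in rad_pow V k /\ c i (a *: y + z) = 0.
  split=> [|a y z [yW cy] [zW cz]]; first by rewrite rpred0.
  split; first by rewrite rpredD ?rpredZ.
  rewrite cD cz addr0; apply: cR => // j ji; apply: IH => //.
  by rewrite -wi.
have: x \in sub_mod cl.
  case/andP: xk => _ /asboolP; apply; split.
  - by move=> y /sub_modP[].
  - by move=> /(_ x xW) /sub_modP[].
  move=> L NL LW.
  have [[l lL cl0]|noL] := pselect (exists2 l, l \in L & c i l <> 0); last first.
    left=> y yL; apply/sub_modP; split; first exact: LW.
    by apply: contrapT => cy; apply: noL; exists y.
  right=> y yW; have lW := LW _ lL.
  rewrite -[y](addrK (sc (- (c i y / c i l)) *: l)) submodB ?rpredZ //.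
  apply: NL; apply/sub_modP; split; first by rewrite rpredD ?rpredZ.
  rewrite cD cZ mulNr divfK ?subrr //; exact/eqP.
by case/sub_modP.
Qed.

(** If N + L is everything, then p = r p + l with l in L and r nilpotent on p, which forces the
    generator p into L. *)
Lemma superfluous_cyclic (p : V) (N : {pred V}) :
  (forall v, exists r : R, v = r *: p) ->
  (forall v, v \in N -> exists (r : R) m, v = r *: p /\ r ^+ m *: p = 0) ->
  superfluous N.
Proof.
move=> gen nil L hL v; have [k [l [kN lL ep]]] := hL p.
have [r [m [ek rp]]] := nil k kN; have [s ->] := gen v.
apply: rpredZ; apply: mem_nilpotent rp.
by rewrite -ek {1}ep addrC addKr.
Qed.

(** Since every nonzero element of W generates w, the submodule Rw is simple and contained in each
    nonzero submodule of W: it is the unique simple one. *)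
Lemma soc_cyclic (W : submodClosed V) w : w \in W -> w != 0 ->
  (forall x, x \in W -> x != 0 -> exists r : R, w = r *: x) -> soc W =i cyclic w.
Proof.
move=> wW w0 hw.
have simple_w : simple_submod (cyclic w).
  split=> [|L LW]; first by exists w => //; apply/cyclicP; exists 1; rewrite scale1r.
  have [[x xL x0]|noL] := pselect (exists2 x, x \in L & x != 0); last first.
    by left=> x xL; apply: contrapT => /eqP x0; apply: noL; exists x.
  right; apply: cyclic_sub.
  have [|r ->] := hw x _ x0; last by rewrite rpredZ.
  by have /cyclicP[r ->] := LW x xL; rewrite rpredZ.
move=> x; apply/asboolP/idP => [hx|xw N hN]; last first.
  exact: (hN _ simple_w (cyclic_sub wW)).
apply: hx => S [[y yS y0] simS] SW.
have [r wE] := hw y (SW y yS) y0.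
have wS : w \in S by rewrite wE rpredZ.
have [w00|//] := simS (cyclic w) (cyclic_sub wS).
by case/eqP: w0; apply: w00; apply/cyclicP; exists 1; rewrite scale1r.
Qed.

Lemma LL_le j : rad_vanishes V j -> (LL V <= j)%N.
Proof. by rewrite /LL => hj; case: pselect => // ex; case: ex_minnP => m _; apply. Qed.

(** The first premise excludes the default value 0 of [LL], for which no lower bound could hold. *)
Lemma LL_ge k : (exists j, rad_vanishes V j) ->
  (forall j, (j < k)%N -> ~ rad_vanishes V j) -> (k <= LL V)%N.
Proof.
rewrite /LL => ex' h; case: pselect => // ex; case: ex_minnP => m hm _.
by rewrite leqNgt; apply/negP => /h.
Qed.

End Submodules.

(** * Projective covers *)

Section Cover.
Variable R : pzRingType.

Section Image.
Variables (V X : lmodType R) (g : {linear V -> X}).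

Lemma im_closed : (exists v, 0 = g v) /\
  forall (a : R) x y, (exists v, x = g v) -> (exists v, y = g v) ->
    exists v, a *: x + y = g v.
Proof.
split=> [|a x y [v ->] [v' ->]]; first by exists 0; rewrite linear0.
by exists (a *: v + v'); rewrite linearP.
Qed.

Definition im : submodClosed X := sub_mod im_closed.

Lemma im_mem v : g v \in im. Proof. by apply/sub_modP; exists v. Qed.

End Image.

Section Corestriction.
Variables (V X : lmodType R) (W : submodClosed X) (g : {linear V -> X}).
Hypothesis gW : forall v, g v \in W.

Definition cores (v : V) : submod W := Sub (g v) (gW v).

Lemma cores_linear : linear cores.
Proof.
move=> a u v; apply: val_inj.
by rewrite [RHS](linearP (val : {linear submod W -> X})) !SubK linearP.
Qed.

HB.instance Definition _ :=
  GRing.isLinear.Build R V (submod W) _ cores cores_linear.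

End Corestriction.

(** [projective] lifts only along maps onto their whole codomain, so both maps are first
    corestricted to the image of [g]. *)
Lemma projective_lift (V V' X : lmodType R) (f : {linear V -> X})
    (g : {linear V' -> X}) : projective V -> (forall v, exists v', g v' = f v) ->
  exists h : {linear V -> V'}, forall v, g (h v) = f v.
Proof.
move=> prV fg.
have fI v : f v \in im g by apply/sub_modP; have [v' <-] := fg v; exists v'.
have [|h hh] := prV _ _ (cores (im_mem g) : {linear V' -> submod (im g)})
  (cores fI : {linear V -> submod (im g)}).
  move=> [x xI]; have /sub_modP[v ev] := xI; exists v.
  by apply: val_inj; rewrite SubK.
by exists h => v; have /(congr1 val) := hh v; rewrite !SubK.
Qed.

(** Two projective covers of a common image. A lift t of f through g is onto because its image and
    ker g span V'; a section s of t satisfies f s = g, so its image and ker f span V and s is onto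
    as well. The compatibility f s = g is what identifies the next kernel in a resolution. *)
Lemma cover_iso (V V' X : lmodType R) (f : {linear V -> X})
    (g : {linear V' -> X}) : projective V -> projective V' ->
  (forall v, exists v', g v' = f v) -> (forall v', exists v, f v = g v') ->
  superfluous (ker_pred f) -> superfluous (ker_pred g) ->
  exists (s : {linear V' -> V}) (t : {linear V -> V'}),
    [/\ forall v', f (s v') = g v', cancel s t & cancel t s].
Proof.
move=> prV prV' fg gf supf supg.
have [t gt] := projective_lift prV fg.
have surj_t v' : exists v, t v = v'.
  suff /sub_modP[v ->] : v' \in im t by exists v.
  apply: supg => u; have [v ev] := gf u; exists (u - t v), (t v).
  by rewrite im_mem subrK -topredE /= /ker_pred linearB gt ev subrr eqxx.
have [s ts] := prV' _ _ t idfun surj_t.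
have fs v' : f (s v') = g v' by rewrite -gt ts.
exists s, t; split=> // v.
suff /sub_modP[v' ->] : v \in im s by rewrite ts.
apply: supf => u; exists (u - s (t u)), (s (t u)).
by rewrite im_mem subrK -topredE /= /ker_pred linearB fs gt subrr eqxx.
Qed.

End Cover.

(** * The modules Hom(G, X) *)

Section HomRetract.
Variables (A : pzRingType) (G X : lmodType A) (inj : hom X G) (prj : hom G X).
Hypothesis injK : cancel inj prj.

(** For a retract X of G the projection generates Hom(G, X), which is the left ideal of an
    idempotent up to isomorphism. *)
Lemma hom_gen (f : hom G X) : f = (hom_comp inj f : (endo G)^c) *: prj.
Proof. by apply: homP => g; rewrite [RHS]injK. Qed.

(** A map out of Hom(G, X) is determined by the image of the generator [prj]; a preimage y of that
    image defines the lift through [hom_gen]. *)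
Lemma hom_projective : projective (hom G X : lmodType (endo G)^c).
Proof.
move=> Y Z g f surj_g; have [y gy] := surj_g (f prj).
pose h (p : hom G X) : Y := (hom_comp inj p : (endo G)^c) *: y.
have hl : linear h.
  move=> r p q; rewrite /h scalerA -scalerDl; congr (_ *: _).
  by apply: homP => x; exact: (raddfD (hom_fun inj)).
pose hh : {linear hom G X -> Y} := HB.pack h (GRing.isLinear.Build _ _ _ _ h hl).
by exists hh => p; rewrite [hh _]/(h p) linearZ /= gy -linearZ -hom_gen.
Qed.

End HomRetract.

(** * The normal forms of paths in A *)

(* The paths that form a basis of A, named after their arrows in the order of
   composition; NE k is ε^k (with ε^0 the trivial path at 1), and NB2A2 stands
   for β2α2 = α1β1. *)
Inductive nform :=
  NE of nat | NA1 | NB1A1 | NE2 | NB1 | NA2 | NB2A2 | NE3 | NB2 | NA2B2.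

Definition nform_code (b : nform) : nat :=
  match b with
  | NA1 => 0 | NB1A1 => 1 | NE2 => 2 | NB1 => 3 | NA2 => 4 | NB2A2 => 5
  | NE3 => 6 | NB2 => 7 | NA2B2 => 8 | NE k => k.+4.+4.+1
  end.
Definition nform_decode (k : nat) : nform :=
  match k with
  | 0 => NA1 | 1 => NB1A1 | 2 => NE2 | 3 => NB1 | 4 => NA2 | 5 => NB2A2
  | 6 => NE3 | 7 => NB2 | 8 => NA2B2 | k.+4.+4.+1 => NE k
  end.
Lemma nform_codeK : cancel nform_code nform_decode. Proof. by case. Qed.
HB.instance Definition _ := Countable.copy nform (can_type nform_codeK).

Definition nlen (b : nform) : nat :=
  match b with
  | NE k => k | NE2 | NE3 => 0 | NA1 | NB1 | NA2 | NB2 => 1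
  | NB1A1 | NB2A2 | NA2B2 => 2
  end.

Definition nsrc (b : nform) : Qvertex :=
  match b with
  | NE _ | NA1 | NB1A1 => V1 | NE2 | NB1 | NA2 | NB2A2 => V2 | _ => V3
  end.

Definition ntgt (b : nform) : Qvertex :=
  match b with
  | NE _ | NB1A1 | NB1 => V1 | NA1 | NE2 | NB2A2 | NB2 => V2 | _ => V3
  end.

Definition nid (v : Qvertex) : nform :=
  match v with V1 => NE 0 | V2 => NE2 | V3 => NE3 end.

Section NormalForms.
Variable n : nat.

(* [lact a b] is the normal form of the product a·b, [None] if that product is
   zero, and [lpre a c] the only b with a·b = c; likewise [ract a b] is the normal
   form of b·a, and [rpre] inverts it. *)
Definition lact (a : Qarrow) (b : nform) : option nform :=
  match a, b with
  | Eps, NE k => if (k.+1 < n)%N then Some (NE k.+1) else None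
  | Alpha1, NE 0 => Some NA1
  | Beta1, NA1 => Some NB1A1
  | Beta1, NE2 => Some NB1
  | Alpha2, NE2 => Some NA2
  | Alpha1, NB1 | Beta2, NA2 => Some NB2A2
  | Beta2, NE3 => Some NB2
  | Alpha2, NB2 => Some NA2B2
  | _, _ => None
  end.

Definition lpre (a : Qarrow) (b : nform) : option nform :=
  match a, b with
  | Eps, NE k.+1 => if (k.+1 < n)%N then Some (NE k) else None
  | Alpha1, NA1 => Some (NE 0)
  | Beta1, NB1A1 => Some NA1
  | Beta1, NB1 => Some NE2
  | Alpha2, NA2 => Some NE2
  | Alpha1, NB2A2 => Some NB1
  | Beta2, NB2A2 => Some NA2
  | Beta2, NB2 => Some NE3
  | Alpha2, NA2B2 => Some NB2
  | _, _ => None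
  end.

Definition ract (a : Qarrow) (b : nform) : option nform :=
  match a, b with
  | Eps, NE k => if (k.+1 < n)%N then Some (NE k.+1) else None
  | Beta1, NE 0 => Some NB1
  | Beta1, NA1 | Alpha2, NB2 => Some NB2A2
  | Alpha1, NE2 => Some NA1
  | Alpha1, NB1 => Some NB1A1
  | Beta2, NE2 => Some NB2
  | Beta2, NA2 => Some NA2B2
  | Alpha2, NE3 => Some NA2
  | _, _ => None
  end.

Definition rpre (a : Qarrow) (b : nform) : option nform :=
  match a, b with
  | Eps, NE k.+1 => if (k.+1 < n)%N then Some (NE k) else None
  | Beta1, NB1 => Some (NE 0)
  | Beta1, NB2A2 => Some NA1
  | Alpha2, NB2A2 => Some NB2
  | Alpha1, NA1 => Some NE2
  | Alpha1, NB1A1 => Some NB1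
  | Beta2, NB2 => Some NE2
  | Beta2, NA2B2 => Some NA2
  | Alpha2, NA2 => Some NE3
  | _, _ => None
  end.

Lemma lactP a b c : lact a b = Some c <-> lpre a c = Some b.
Proof.
case: a b c => [] [[|k]| | | | | | | | |] [[|l]| | | | | | | | |] //=;
  (try by case: ifP); split; case: ifP => // h [e]; subst; rewrite h //.
Qed.

Lemma ractP a b c : ract a b = Some c <-> rpre a c = Some b.
Proof.
case: a b c => [] [[|k]| | | | | | | | |] [[|l]| | | | | | | | |] //=;
  (try by case: ifP); split; case: ifP => // h [e]; subst; rewrite h //.
Qed.

(** Associativity (c b) a = c (b a) for normal forms, zero products included. *)
Lemma lact_ract a c b : obind (ract a) (lact c b) = obind (lact c) (ract a b).
Proof.
case: a c b => [] [] [[|k]| | | | | | | | |] //=; case: ifP => //= h.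
Qed.

Lemma lact_some a b c : lact a b = Some c ->
  [/\ ntgt b = src (a : arrow quivQ), ntgt c = tgt (a : arrow quivQ),
      nsrc c = nsrc b & nlen c = (nlen b).+1].
Proof.
by case: a b => [] [[|k]| | | | | | | | |] //=; try case: ifP => // _;
  move=> [<-].
Qed.

Lemma ract_some a b c : ract a b = Some c ->
  [/\ nsrc b = tgt (a : arrow quivQ), ntgt c = ntgt b & nsrc c = src (a : arrow quivQ)].
Proof.
by case: a b => [] [[|k]| | | | | | | | |] //=; try case: ifP => // _;
  move=> [<-].
Qed.

(** Arrows act on the left in the order of traversal; [None] encodes the value zero. *)
Definition cls (p : qpath quivQ) : option nform :=
  foldl (fun o a => obind (lact a) o) (Some (nid (path_data p).1))
    (path_data p).2.

End NormalForms.

(** * Induction in the path algebra by left multiplication with arrows *)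

Lemma path_mulZl (K : fieldType) (Q : quiver) c (x y : path_alg K Q) :
  path_mul (c *: x) y = c *: path_mul x y.
Proof. by rewrite !path_mulE linearZ. Qed.

Lemma path_mulZr (K : fieldType) (Q : quiver) c (x y : path_alg K Q) :
  path_mul x (c *: y) = c *: path_mul x y.
Proof. by rewrite -[c *: y]addr0 path_mulr path_mul0 addr0. Qed.

Section PathInduction.
Variable K : fieldType.
Local Notation elt p := (@path_elt K quivQ p).

Lemma arr_mul_elt a p : path_tgt p = src (a : arrow quivQ) ->
  exists2 q, arr K a * elt p = elt q &
    path_data q = (path_src p, rcons (path_data p).2 a).
Proof.
move=> e; have := @path_compE _ (arrow_path (a : arrow quivQ)) p e.
case eq: (path_comp _ p) => [q|] //= [eqq]; exists q; last by rewrite eqq cats1.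
have -> : arr K a * elt p = basis_mul K (arrow_path (a : arrow quivQ)) p.
  exact: path_mul_elt.
by rewrite /basis_mul eq.
Qed.

Lemma path_alg_ind (T : path_alg K quivQ -> Prop) : T 0 ->
  (forall a x y, T x -> T y -> T (a *: x + y)) ->
  (forall v, T (elt (trivial_path v))) ->
  (forall a x, T x -> T (arr K a * x)) -> forall x, T x.
Proof.
move=> T0 TL Te Ta; elim/path_sum_ind=> // -[[v s] h].
elim/last_ind: s h => [|s a IH] h.
  suff -> : QPath h = trivial_path v by [].
  exact: val_inj.
have hs : walk (v, s).1 (v, s).2 by move: h; rewrite -cats1 /= walk_cat => /andP[].
have ha : path_tgt (QPath hs) = src a.
  by move: h; rewrite -cats1 /= walk_cat /= andbT => /andP[_ /eqP].
have [q eq dq] := arr_mul_elt ha.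
suff -> : QPath h = q by rewrite -eq; apply: Ta; exact: IH.
by apply: val_inj; rewrite [RHS]dq.
Qed.

End PathInduction.

(** * Coefficient functionals on the path algebra *)

Section Coordinates.
Variables (K : fieldType) (n : nat).
Hypothesis n_gt1 : (1 < n)%N.
Local Notation elt p := (@path_elt K quivQ p).

Definition cp (b : nform) : {linear path_alg K quivQ -> K^o} :=
  lin_ext (fun p => (cls n p == Some b)%:R : K^o).

Lemma cp_elt b p : cp b (elt p) = (cls n p == Some b)%:R.
Proof. exact: lin_ext_elt. Qed.

Lemma cls_ends p b : cls n p = Some b -> ntgt b = path_tgt p /\ nsrc b = path_src p.
Proof.
case: p => -[v s] h; rewrite /cls /path_tgt /path_src /= {h}.
elim/last_ind: s b => [|s a IH] b /=; first by case=> <-; case: v.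
rewrite -cats1 foldl_cat /= map_cat last_cat /=.
case: (foldl _ _ _) IH => //= c IH /lact_some[_ -> ->] _.
by case: (IH c erefl).
Qed.

Lemma cls_rcons p q a : path_data q = (path_src p, rcons (path_data p).2 a) ->
  cls n q = obind (lact n a) (cls n p).
Proof. by rewrite /cls => ->; rewrite -cats1 foldl_cat. Qed.

(** Left action by an arrow is injective where it is nonzero, so at most one coefficient of [x] can
    contribute, the one at [lpre n a b]. *)
Lemma cp_arrM b a x : cp b (arr K a * x) = oapp (cp^~ x) 0 (lpre n a b).
Proof.
elim/path_sum_ind: x => [|c x y IHx IHy|p].
- by rewrite mulr0 linear0; case: lpre => //= ?; rewrite linear0.
- have -> : arr K a * (c *: x + y) = c *: (arr K a * x) + arr K a * y.
    exact: path_mulr.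
  rewrite linearP IHx IHy; case: lpre => [b'|] /=; first by rewrite linearP.
  by rewrite scaler0 addr0.
have [e|ne] := eqVneq (path_tgt p) (src (a : arrow quivQ)).
  have [q -> dq] := arr_mul_elt K e.
  rewrite cp_elt (cls_rcons dq).
  case ep: (cls n p) => [c|] /=; last first.
    by case: lpre => //= b'; rewrite cp_elt ep.
  case eb: (lpre n a b) => [b'|] /=.
    rewrite cp_elt ep; congr (_%:R); congr nat_of_bool; apply/eqP/eqP.
      by move/lactP; rewrite eb => -[->].
    by case=> ->; apply/lactP.
  by case: eqP => // /lactP; rewrite eb.
have -> : arr K a * elt p = basis_mul K (arrow_path (a : arrow quivQ)) p.
  exact: path_mul_elt.
rewrite /basis_mul path_comp_None //= linear0.
case eb: (lpre n a b) => [b'|] //=; rewrite cp_elt; case: eqP => // ep.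
have [e _] := cls_ends ep; have [e' _ _ _] := lact_some (proj2 (lactP n a b' b) eb).
by rewrite -e e' eqxx in ne.
Qed.

Lemma cp_id b v : cp b (elt (trivial_path v)) = (b == nid v)%:R.
Proof. by rewrite cp_elt /cls /= eq_sym. Qed.

Lemma cp_idM b v x :
  cp b (elt (trivial_path v) * x) = (ntgt b == v)%:R * cp b x.
Proof.
elim/path_sum_ind: x => [|c x y IHx IHy|p].
- by rewrite mulr0 !linear0 mulr0.
- have -> : elt (trivial_path v) * (c *: x + y)
          = c *: (elt (trivial_path v) * x) + elt (trivial_path v) * y.
    exact: path_mulr.
  by rewrite !linearP IHx IHy mulrDr scalerAr.
have -> : elt (trivial_path v) * elt p = basis_mul K (trivial_path v) p.
  exact: path_mul_elt.
rewrite /basis_mul; have [e|ne] := eqVneq (path_tgt p) v.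
  rewrite -e path_comp1p /= cp_elt; case: (cls n p =P _) => [/cls_ends[-> _]|_].
    by rewrite eqxx mul1r.
  by rewrite mulr0.
rewrite path_comp_None //= linear0 cp_elt; case: (cls n p =P _) => [/cls_ends[-> _]|_].
  by rewrite (negPf ne) mul0r.
by rewrite mulr0.
Qed.

Lemma cp_Mid b v x :
  cp b (x * elt (trivial_path v)) = (nsrc b == v)%:R * cp b x.
Proof.
elim/path_sum_ind: x => [|c x y IHx IHy|p].
- by rewrite mul0r !linear0 mulr0.
- have -> : (c *: x + y) * elt (trivial_path v)
          = c *: (x * elt (trivial_path v)) + y * elt (trivial_path v).
    exact: path_mull.
  by rewrite !linearP IHx IHy mulrDr scalerAr.
have -> : elt p * elt (trivial_path v) = basis_mul K p (trivial_path v).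
  exact: path_mul_elt.
rewrite /basis_mul; have [e|ne] := eqVneq v (path_src p).
  rewrite e path_compp1 /= cp_elt; case: (cls n p =P _) => [/cls_ends[_ ->]|_].
    by rewrite eqxx mul1r.
  by rewrite mulr0.
rewrite path_comp_None //= linear0 cp_elt; case: (cls n p =P _) => [/cls_ends[_ ->]|_].
  by rewrite eq_sym (negPf ne) mul0r.
by rewrite mulr0.
Qed.

Lemma nid_eq u v : (nid u == nid v) = (u == v).
Proof. by apply/eqP/eqP => [|->//]; case: u v => [] []. Qed.

Lemma ntgt_nid v : ntgt (nid v) = v. Proof. by case: v. Qed.
Lemma nsrc_nid v : nsrc (nid v) = v. Proof. by case: v. Qed.

Lemma nid_arr a :
  lact n a (nid (src (a : arrow quivQ))) = ract n a (nid (tgt (a : arrow quivQ))).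
Proof. by case: a. Qed.

(** [cls] is defined by left actions, so right multiplication is not visible in it. Induction over
    left arrows reduces the rule to [lact_ract]; the case split records which preimages under the
    two actions exist. *)
Lemma cp_Marr b a x : cp b (x * arr K a) = oapp (cp^~ x) 0 (rpre n a b).
Proof.
elim/path_alg_ind: x b => [|c x y IHx IHy|v|a' x IH] b.
- by rewrite mul0r linear0; case: rpre => //= ?; rewrite linear0.
- have -> : (c *: x + y) * arr K a = c *: (x * arr K a) + y * arr K a.
    exact: path_mull.
  rewrite linearP IHx IHy; case: rpre => [b'|] /=; first by rewrite linearP.
  by rewrite scaler0 addr0.
- rewrite cp_idM cp_elt [cls _ _]nid_arr.
  case: (ract n a _ =P _) => [e|ne] /=.
    have [_ h _] := ract_some e; move/ractP: (e) => -> /=.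
    by rewrite mulr1 cp_id h ntgt_nid nid_eq.
  rewrite mulr0; case eb: (rpre n a b) => [b'|] //=.
  move/ractP: eb => eb; have [h _ _] := ract_some eb.
  rewrite cp_id; case: eqP => // eb'; case: ne.
  by rewrite -eb -h eb' nsrc_nid.
rewrite -mulrA !cp_arrM; case eb: (lpre n a' b) => [b'|] /=.
  rewrite IH; case eb': (rpre n a b') => [b''|] /=.
    have h : obind (ract n a) (lact n a' b'') = Some b.
      rewrite lact_ract; have -> : ract n a b'' = Some b' by apply/ractP.
      by apply/lactP.
    case ec: (lact n a' b'') h => [c|] //= /ractP->.
    by rewrite /= cp_arrM; move/lactP: ec => ->.
  case ec: (rpre n a b) => [c|] //=; rewrite cp_arrM.
  case ed: (lpre n a' c) => [d|] //=.
  have : obind (lact n a') (ract n a d) = Some b.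
    rewrite -lact_ract; have -> : lact n a' d = Some c by apply/lactP.
    by apply/ractP.
  case ef: (ract n a d) => [f|] //= /lactP; rewrite eb => -[ff].
  by move/ractP: ef; rewrite -ff eb'.
case ec: (rpre n a b) => [c|] //=; rewrite cp_arrM.
case ed: (lpre n a' c) => [d|] //=.
have : obind (lact n a') (ract n a d) = Some b.
  rewrite -lact_ract; have -> : lact n a' d = Some c by apply/lactP.
  by apply/ractP.
by case ef: (ract n a d) => [f|] //= /lactP; rewrite eb.
Qed.

Definition cp_ker : {pred path_alg K quivQ} := fun x => `[< forall b, cp b x = 0 >].

Lemma cp_ker_zmod : zmod_closed cp_ker.
Proof.
split=> [|x y /asboolP hx /asboolP hy]; apply/asboolP => b.
  exact: linear0.
by rewrite linearB hx hy subrr.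
Qed.

HB.instance Definition _ := GRing.isZmodClosed.Build _ cp_ker cp_ker_zmod.

(** Multiplying by an arrow on either side turns each coordinate into another coordinate of [x] or
    into zero, so the common kernel absorbs arrows. *)
Lemma cp_ker_two_sided : two_sided cp_ker.
Proof.
move=> y x /asboolP hx; split; apply/asboolP.
  elim/path_alg_ind: y => [|c y z IHy IHz|v|a y IH] b.
  - by rewrite mul0r linear0.
  - have -> : (c *: y + z) * x = c *: (y * x) + z * x by exact: path_mull.
    by rewrite linearP IHy IHz scaler0 addr0.
  - by rewrite cp_idM hx mulr0.
  by rewrite -mulrA cp_arrM; case: lpre => //= b'.
elim/path_alg_ind: y x hx => [|c y z IHy IHz|v|a y IH] x hx b.
- by rewrite mulr0 linear0.
- have -> : x * (c *: y + z) = c *: (x * y) + x * z by exact: path_mulr.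
  by rewrite linearP IHy // IHz // scaler0 addr0.
- by rewrite cp_Mid hx mulr0.
by rewrite mulrA; apply: IH => b'; rewrite cp_Marr; case: rpre => //= c.
Qed.

HB.instance Definition _ := isTwoSided.Build _ cp_ker cp_ker_two_sided.

Lemma cp_arr b a :
  cp b (arr K a) = (lact n a (nid (src (a : arrow quivQ))) == Some b)%:R.
Proof. exact: cp_elt. Qed.

Lemma cp_eps_exp j k : (j < k)%N -> cp (NE j) (arr K Eps ^+ k) = 0.
Proof.
elim: k j => // k IH [|j] jk; first by rewrite exprS cp_arrM.
by rewrite exprS cp_arrM /=; case: ifP => //= _; exact: IH.
Qed.

Lemma relations_ker : {subset relations K n <= cp_ker}.
Proof.
have h a c b : cp b (arr K a * arr K c)
    = oapp (fun b' => (lact n c (nid (src (c : arrow quivQ))) == Some b')%:R) 0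
        (lpre n a b).
  by rewrite cp_arrM; case: lpre => //= b'; rewrite cp_arr.
move=> x; rewrite !inE => hx; apply/asboolP => b; move: hx.
have n0 : n = n.-1.+1 by rewrite prednK // ltnW.
do ![case/orP]; move/eqP->.
- by rewrite h; case: b => [[|k]| | | | | | | | |].
- by rewrite h; case: b => [[|k]| | | | | | | | |].
- by rewrite linearB /= !h; case: b => [[|k]| | | | | | | | |]; rewrite //= subrr.
- by rewrite h; case: b => [[|k]| | | | | | | | |] //=; case: ifP.
- by rewrite h; case: b => [[|k]| | | | | | | | |] //=; rewrite n_gt1.
(* For ε^n: beyond [NE (n-1)] and off the powers of ε there is no preimage under ε, while at [NE k]
   with k < n the exponent n is too large. *)
have [bk|] := boolP (if b is NE k then (n <= k)%N else true).
  rewrite n0 exprS cp_arrM; case: b bk => [[|k]| | | | | | | | |] //=.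
  by rewrite leqNgt => /negPf->.
by case: b => // k; rewrite -ltnNge; exact: cp_eps_exp.
Qed.

(** * Passage to the quotient A *)

Local Notation A := (algA K n).

Definition qa (x : path_alg K quivQ) : A := quot_proj (ideal_gen (relations K n)) x.
Definition algA_qarr (a : Qarrow) : A := qa (arr K a).
Local Notation ev v := (idem K n v).
Definition algA_sc (c : K) : A := qa (c *: path_one K quivQ).
Definition algA_cf (b : nform) (x : A) : K := cp b (repr x).

(** Independence of the representative: the generated ideal is contained in every ideal that
    contains the relations, in particular in [cp_ker]. *)
Lemma algA_cf_qa b x : algA_cf b (qa x) = cp b x.
Proof.
apply/eqP; rewrite -subr_eq0 -[_ - _]linearB /=; apply/eqP.
have : repr (qa x) - x \in ideal_gen (relations K n).
  by apply/quot_projP; rewrite quot_reprK.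
move=> /asboolP /(_ cp_ker relations_ker) /asboolP; exact.
Qed.

Lemma qaD x y : qa (x + y) = qa x + qa y. Proof. exact: quot_projD. Qed.
Lemma qaM x y : qa (x * y) = qa x * qa y. Proof. exact: quot_projM. Qed.

Lemma algA_scM c x : algA_sc c * qa x = qa (c *: x).
Proof.
rewrite -qaM; congr qa.
by rewrite [LHS](path_mulZl c (path_one K quivQ) x) path_mul1.
Qed.

Lemma algA_Msc c x : x * algA_sc c = algA_sc c * x.
Proof.
elim/quot_ind: x => x; rewrite [RHS]algA_scM -[quot_proj _ _]/(qa x) -qaM; congr qa.
by rewrite [LHS](path_mulZr c x (path_one K quivQ)) path_mulr1.
Qed.

Lemma algA_sc1 : algA_sc 1 = 1. Proof. by rewrite /algA_sc scale1r. Qed.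
Lemma qa0 : qa 0 = 0.
Proof. by apply: (@addrI _ (qa 0)); rewrite -qaD !addr0. Qed.
Lemma algA_sc0 : algA_sc 0 = 0. Proof. by rewrite /algA_sc scale0r qa0. Qed.
Lemma algA_scA c d : algA_sc (c * d) = algA_sc c * algA_sc d.
Proof. by rewrite algA_scM scalerA. Qed.
Lemma algA_scD c d : algA_sc (c + d) = algA_sc c + algA_sc d.
Proof. by rewrite /algA_sc scalerDl qaD. Qed.

Lemma algA_cfD b x y : algA_cf b (x + y) = algA_cf b x + algA_cf b y.
Proof.
elim/quot_ind: x => x; elim/quot_ind: y => y.
by rewrite -quot_projD !algA_cf_qa linearD.
Qed.

Lemma algA_cf_sc b c x : algA_cf b (algA_sc c * x) = c * algA_cf b x.
Proof. by elim/quot_ind: x => x; rewrite [_ * _]algA_scM !algA_cf_qa linearZ. Qed.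

Lemma algA_cf_arrM b a x :
  algA_cf b (algA_qarr a * x) = oapp (algA_cf^~ x) 0 (lpre n a b).
Proof.
elim/quot_ind: x => x; rewrite -[_ * _]qaM algA_cf_qa cp_arrM.
by case: lpre => //= b'; rewrite algA_cf_qa.
Qed.

Lemma algA_cf_idM b v x : algA_cf b (ev v * x) = (ntgt b == v)%:R * algA_cf b x.
Proof. by elim/quot_ind: x => x; rewrite -[_ * _]qaM !algA_cf_qa cp_idM. Qed.

Lemma algA_cf_Mid b v x : algA_cf b (x * ev v) = (nsrc b == v)%:R * algA_cf b x.
Proof. by elim/quot_ind: x => x; rewrite -[_ * _]qaM !algA_cf_qa cp_Mid. Qed.

Lemma algA_cf_id b v : algA_cf b (ev v) = (b == nid v)%:R.
Proof. by rewrite [LHS]algA_cf_qa cp_id. Qed.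

Lemma algA_ind (T : A -> Prop) : T 0 ->
  (forall a x y, T x -> T y -> T (algA_sc a * x + y)) -> (forall v, T (ev v)) ->
  (forall a x, T x -> T (algA_qarr a * x)) -> forall x, T x.
Proof.
move=> T0 TL Te Ta; elim/quot_ind; elim/path_alg_ind => [|c x y Tx Ty|v|a x Tx].
- by have -> : quot_proj (ideal_gen (relations K n)) 0 = 0 by exact: qa0.
- by rewrite [quot_proj _ _]qaD -algA_scM; exact: TL.
- exact: Te.
by rewrite [quot_proj _ _]qaM; exact: Ta.
Qed.

Lemma algA_id_id u v : ev u * ev v = if u == v then ev v else 0.
Proof.
rewrite -[_ * _]qaM.
have -> : elt (@trivial_path quivQ u) * elt (@trivial_path quivQ v)
   = basis_mul K (@trivial_path quivQ u) (@trivial_path quivQ v) by exact: path_mul_elt.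
rewrite /basis_mul; case: eqP => [->|ne].
  by have /= -> := @path_comp1p quivQ (@trivial_path quivQ v).
rewrite path_comp_None; first exact: qa0.
by apply/eqP => e; apply: ne.
Qed.

Lemma algA_id_arr a : ev (tgt (a : arrow quivQ)) * algA_qarr a = algA_qarr a.
Proof.
rewrite -[_ * _]qaM; congr qa.
have -> : elt (@trivial_path quivQ (tgt (a : arrow quivQ))) * arr K a
   = basis_mul K (@trivial_path quivQ (tgt (a : arrow quivQ)))
       (arrow_path (a : arrow quivQ)).
  exact: path_mul_elt.
by rewrite /basis_mul (path_comp1p (arrow_path (a : arrow quivQ))).
Qed.

Lemma algA_arr_id a : algA_qarr a * ev (src (a : arrow quivQ)) = algA_qarr a.
Proof.
rewrite -[_ * _]qaM; congr qa.
have -> : arr K a * elt (@trivial_path quivQ (src (a : arrow quivQ)))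
   = basis_mul K (arrow_path (a : arrow quivQ))
       (@trivial_path quivQ (src (a : arrow quivQ))).
  exact: path_mul_elt.
by rewrite /basis_mul (path_compp1 (arrow_path (a : arrow quivQ))).
Qed.

Lemma rel0 i : (i < 6)%N -> qa (nth 0 (relations K n) i) = 0.
Proof.
move=> i6; rewrite -[RHS]qa0; apply/quot_projP; rewrite subr0.
by apply/asboolP => J; apply; exact: mem_nth.
Qed.

Lemma relations0 :
  [/\ algA_qarr Alpha2 * algA_qarr Alpha1 = 0, algA_qarr Beta1 * algA_qarr Beta2 = 0,
      algA_qarr Beta2 * algA_qarr Alpha2 = algA_qarr Alpha1 * algA_qarr Beta1,
      algA_qarr Eps * algA_qarr Beta1 = 0 & algA_qarr Alpha1 * algA_qarr Eps = 0]
  /\ algA_qarr Eps ^+ n = 0.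
Proof.
split; last first.
  have h k : algA_qarr Eps ^+ k = qa (arr K Eps ^+ k).
    by elim: k => [|k IH]; rewrite ?expr0 // 2!exprS IH -qaM.
  by rewrite h; exact: (@rel0 5).
split.
- by rewrite -qaM; exact: (@rel0 0).
- by rewrite -qaM; exact: (@rel0 1).
- rewrite -!qaM; apply/quot_projP; apply/asboolP => J; apply.
  exact: (@mem_nth _ 0 (relations K n) 2).
- by rewrite -qaM; exact: (@rel0 3).
by rewrite -qaM; exact: (@rel0 4).
Qed.


End Coordinates.

(** * Coordinates of A *)

(* The multiplication rules of A, abstracted from its construction as a quotient
   of a path algebra: [cf b x] is the coefficient of x at the basis path b. *)
Record coordinates (K : fieldType) (n : nat) (A : pzRingType)
    (ev : Qvertex -> A) := Coordinates {
  qarr : Qarrow -> A;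
  sc : K -> A;
  cf : nform -> A -> K;
  sc0 : sc 0 = 0;
  sc1 : sc 1 = 1;
  scD : forall c d, sc (c + d) = sc c + sc d;
  scA : forall c d, sc (c * d) = sc c * sc d;
  Msc : forall c x, x * sc c = sc c * x;
  cfD : forall b x y, cf b (x + y) = cf b x + cf b y;
  cf_sc : forall b c x, cf b (sc c * x) = c * cf b x;
  cf_arrM : forall b a x, cf b (qarr a * x) = oapp (cf^~ x) 0 (lpre n a b);
  cf_idM : forall b v x, cf b (ev v * x) = (ntgt b == v)%:R * cf b x;
  cf_Mid : forall b v x, cf b (x * ev v) = (nsrc b == v)%:R * cf b x;
  cf_id : forall b v, cf b (ev v) = (b == nid v)%:R;
  alg_ind : forall T : A -> Prop, T 0 ->
    (forall a x y, T x -> T y -> T (sc a * x + y)) -> (forall v, T (ev v)) ->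
    (forall a x, T x -> T (qarr a * x)) -> forall x, T x;
  id_id : forall u v, ev u * ev v = if u == v then ev v else 0;
  id_arr : forall a, ev (tgt (a : arrow quivQ)) * qarr a = qarr a;
  arr_id : forall a, qarr a * ev (src (a : arrow quivQ)) = qarr a;
  rel_21 : qarr Alpha2 * qarr Alpha1 = 0;
  rel_12 : qarr Beta1 * qarr Beta2 = 0;
  rel_comm : qarr Beta2 * qarr Alpha2 = qarr Alpha1 * qarr Beta1;
  rel_eb : qarr Eps * qarr Beta1 = 0;
  rel_ae : qarr Alpha1 * qarr Eps = 0;
  rel_exp : qarr Eps ^+ n = 0 }.

Section Basis.
Variables (K : fieldType) (n : nat) (A : pzRingType) (ev : Qvertex -> A).
Hypothesis n_gt1 : (1 < n)%N.
Variable C : coordinates K n ev.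
Local Notation qarr := (qarr C).
Local Notation sc := (sc C).
Local Notation cf := (cf C).
Local Notation sc0 := (sc0 C).
Local Notation sc1 := (sc1 C).
Local Notation scD := (scD C).
Local Notation scA := (scA C).
Local Notation Msc := (Msc C).
Local Notation cfD := (cfD C).
Local Notation cf_sc := (cf_sc C).
Local Notation cf_arrM := (cf_arrM C).
Local Notation cf_idM := (cf_idM C).
Local Notation cf_Mid := (cf_Mid C).
Local Notation cf_id := (cf_id C).
Local Notation alg_ind := (@alg_ind _ _ _ _ C).
Local Notation id_id := (id_id C).
Local Notation id_arr := (id_arr C).
Local Notation arr_id := (arr_id C).

Lemma cf0 b : cf b 0 = 0.
Proof. by apply: (@addrI _ (cf b 0)); rewrite -cfD !addr0. Qed.

Lemma cfN b x : cf b (- x) = - cf b x.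
Proof. by apply: (@addrI _ (cf b x)); rewrite -cfD !subrr cf0. Qed.

Lemma cfB b x y : cf b (x - y) = cf b x - cf b y.
Proof. by rewrite cfD cfN. Qed.

Lemma cf_sum b (I : Type) (s : seq I) F :
  cf b (\sum_(i <- s) F i) = \sum_(i <- s) cf b (F i).
Proof. exact: (big_morph _ (cfD b) (cf0 b)). Qed.

Definition rep (b : nform) : A :=
  match b with
  | NE k => qarr Eps ^+ k * ev V1
  | NA1 => qarr Alpha1 * ev V1
  | NB1A1 => qarr Beta1 * (qarr Alpha1 * ev V1)
  | NE2 => ev V2
  | NB1 => qarr Beta1 * ev V2
  | NA2 => qarr Alpha2 * ev V2
  | NB2A2 => qarr Beta2 * (qarr Alpha2 * ev V2)
  | NE3 => ev V3
  | NB2 => qarr Beta2 * ev V3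
  | NA2B2 => qarr Alpha2 * (qarr Beta2 * ev V3)
  end.

Lemma ev_arr a x : ev (tgt (a : arrow quivQ)) * (qarr a * x) = qarr a * x.
Proof. by rewrite mulrA id_arr. Qed.

Lemma ev_rep b : ev (ntgt b) * rep b = rep b.
Proof.
case: b => [[|k]| | | | | | | | |] /=; rewrite ?exprS -?mulrA.
- by rewrite expr0 mul1r id_id eqxx.
- exact: (ev_arr Eps).
- exact: (ev_arr Alpha1).
- exact: (ev_arr Beta1).
- by rewrite id_id eqxx.
- exact: (ev_arr Beta1).
- exact: (ev_arr Alpha2).
- exact: (ev_arr Beta2).
- by rewrite id_id eqxx.
- exact: (ev_arr Beta2).
exact: (ev_arr Alpha2).
Qed.

Lemma rep_ev b : rep b * ev (nsrc b) = rep b.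
Proof. by case: b => [[|k]| | | | | | | | |]; rewrite /rep -?mulrA id_id eqxx. Qed.

Lemma rep_nid v : rep (nid v) = ev v.
Proof. by case: v => //; rewrite /= mul1r. Qed.

Lemma arr_ev0 a v x : src (a : arrow quivQ) != v -> qarr a * (ev v * x) = 0.
Proof.
move=> ne; rewrite -[qarr a]arr_id -mulrA [_ * (ev v * x)]mulrA id_id.
by rewrite (negPf ne) mul0r mulr0.
Qed.

(** Zero products come from mismatched endpoints, from a monomial relation, or, for paths such as
    α1β1α1, from exchanging α1β1 and β2α2 until α2α1 or β1β2 appears. *)
Lemma arr_rep a b : qarr a * rep b = oapp rep 0 (lact n a b).
Proof.
have [[[r1 r2] r3] r4] := (rel_21 C, rel_12 C, rel_comm C, rel_eb C).
have r5 := rel_ae C; have r6 := rel_exp C.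
have [e|ne] := eqVneq (src (a : arrow quivQ)) (ntgt b); last first.
  rewrite -ev_rep arr_ev0 //; case eb: (lact n a b) => [c|] //.
  by have [e _ _ _] := lact_some eb; rewrite e eqxx in ne.
case: a b e => [] [[|k]| | | | | | | | |] //= _;
  rewrite ?expr0 ?exprS ?mul1r ?n_gt1 ?expr1 // ?mulrA ?(r1, r2, r4, r5, mul0r) //.
- case: ifP => hk /=; first by rewrite !exprS mulrA.
  have -> : qarr Eps * qarr Eps * qarr Eps ^+ k = 0.
    have hk' : (n <= k.+2)%N by rewrite leqNgt hk.
    rewrite -mulrA -[qarr Eps * qarr Eps ^+ k]exprS -[LHS]exprS -(subnK hk').
    by rewrite exprD r6 mulr0.
  by rewrite mul0r.
- by rewrite -r3 -[_ * qarr Alpha1]mulrA r1 mulr0 mul0r.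
- by rewrite r3.
- by rewrite -[_ * qarr Alpha2]mulrA r3 mulrA r1 !mul0r.
by rewrite r3 -[_ * qarr Beta2]mulrA r2 mulr0 mul0r.
Qed.

Definition valid (b : nform) : bool := if b is NE k then (k < n)%N else true.

Definition bs : seq nform :=
  [seq NE k | k <- iota 0 n]
  ++ [:: NA1; NB1A1; NE2; NB1; NA2; NB2A2; NE3; NB2; NA2B2].

Lemma mem_bs b : (b \in bs) = valid b.
Proof.
rewrite mem_cat; case: b => [k| | | | | | | | |] /=; last first.
all: try by rewrite orbT.
rewrite orbF mem_map ?mem_iota //; by move=> x y [].
Qed.

Lemma uniq_bs : uniq bs.
Proof.
rewrite cat_uniq map_inj_uniq ?iota_uniq; last by move=> x y [].
rewrite andbT; apply/hasP => -[b hb /mapP[k _ eb]]; move: hb.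
by rewrite eb.
Qed.

Lemma valid_lact a b c : lact n a b = Some c -> valid c.
Proof.
by case: a b => [] [[|k]| | | | | | | | |] //=; try case: ifP => // h;
  move=> [<-].
Qed.

Let spanned (x : A) := exists c : nform -> K, x = \sum_(b <- bs) sc (c b) * rep b.

Let spannedL c x y : spanned x -> spanned y -> spanned (sc c * x + y).
Proof.
move=> [d ->] [e ->]; exists (fun b => c * d b + e b).
rewrite mulr_sumr -big_split /=; apply: eq_bigr => b _.
by rewrite scD scA mulrDl mulrA.
Qed.

Let spanned0 : spanned 0.
Proof. by exists (fun=> 0); rewrite big1 // => b _; rewrite sc0 mul0r. Qed.

Let spanned_rep b : valid b -> spanned (rep b).
Proof.
rewrite -mem_bs => hb; exists (fun c => (c == b)%:R).
rewrite (bigD1_seq b) ?uniq_bs //= eqxx sc1 mul1r big1 ?addr0 // => c /negPf->.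
by rewrite sc0 mul0r.
Qed.

Let spanned_all x : spanned x.
Proof.
elim/alg_ind: x => [//|c x y|v|a x [c ->]]; first exact: spannedL.
  rewrite -rep_nid; apply: spanned_rep; case: v => //=; exact: ltnW.
rewrite mulr_sumr; elim: bs => [|b s IH]; first by rewrite big_nil.
rewrite big_cons mulrA Msc -mulrA arr_rep; apply: spannedL => //.
by case e: (lact n a b) => [b'|] //=; apply: spanned_rep; exact: valid_lact e.
Qed.

Lemma cf_rep b b' : valid b' -> cf b (rep b') = (b == b')%:R.
Proof.
have cfe v c : cf c (ev v) = (c == nid v)%:R by rewrite cf_id.
case: b' => [k| | | | | | | | |] /=; last first.
1-9: move=> _; case: b => [[|l]| | | | | | | | |]; rewrite ?(cf_arrM, cf_id) //=;
   try case: ifP => //= _; rewrite ?(cf_arrM, cf_id, cf0) //=.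
elim: k b => [|k IH] b hk; first by rewrite mul1r cf_id.
rewrite exprS -mulrA cf_arrM //; case: b => [[|l]| | | | | | | | |] //=.
case: ifP => /= hl; first by rewrite IH // ltnW.
by case: eqP => // -[e]; rewrite e hk in hl.
Qed.

(** Spanning supplies some coefficients; the duality [cf_rep] identifies them as the values of
    [cf]. *)
Lemma alg_expand x : x = \sum_(b <- bs) sc (cf b x) * rep b.
Proof.
have [c e] := spanned_all x.
rewrite [LHS]e; apply: eq_big_seq => b hb; congr (sc _ * _).
rewrite e cf_sum // (bigD1_seq b) ?uniq_bs //= cf_sc // cf_rep -?mem_bs // eqxx mulr1.
rewrite big_seq_cond big1 ?addr0 // => b' /andP[hb' ne].
by rewrite cf_sc // cf_rep -?mem_bs // eq_sym (negPf ne) mulr0.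
Qed.

Lemma cf_sep x y : (forall b, cf b x = cf b y) -> x = y.
Proof.
by move=> h; rewrite [x]alg_expand [y]alg_expand; apply: eq_bigr => b _; rewrite h.
Qed.

Lemma cf_invalid b x : ~~ valid b -> cf b x = 0.
Proof.
move=> nb; rewrite (alg_expand x) cf_sum // big_seq_cond big1 // => b'.
rewrite andbT => hb'.
rewrite cf_sc // cf_rep -?mem_bs //; case: eqP => [e|]; last by rewrite mulr0.
by rewrite -mem_bs e hb' in nb.
Qed.

(* The k-th power of the ideal generated by the arrows. *)
Definition filt (k : nat) (x : A) : Prop := forall b, (nlen b < k)%N -> cf b x = 0.

Lemma filt_arr a k x : filt k x -> filt k.+1 (qarr a * x).
Proof.
move=> hx b hb; rewrite cf_arrM //; case e: lpre => [c|] //=; apply: hx.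
by have [_ _ _ h] := lact_some (proj2 (lactP n a c b) e); rewrite h in hb.
Qed.

Lemma filt_sc c k x : filt k x -> filt k (sc c * x).
Proof. by move=> hx b hb; rewrite cf_sc // hx // mulr0. Qed.

Lemma filtD k x y : filt k x -> filt k y -> filt k (x + y).
Proof. by move=> hx hy b hb; rewrite cfD // hx // hy // addr0. Qed.

Lemma filt0 k : filt k 0. Proof. by move=> b _; rewrite cf0. Qed.

Lemma filt_sum k (F : nform -> A) (s : seq nform) :
  (forall b, b \in s -> filt k (F b)) -> filt k (\sum_(b <- s) F b).
Proof.
move=> h; rewrite big_seq; elim/big_ind: _ => //; [exact: filt0|].
by move=> x y; exact: filtD.
Qed.

Lemma filt_le k l x : (k <= l)%N -> filt l x -> filt k x.
Proof. by move=> kl h b bk; apply: h; exact: leq_trans kl. Qed.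

Lemma filt_rep b : filt (nlen b) (rep b).
Proof.
move=> c hc; have [vb|nb] := boolP (valid b).
  by rewrite cf_rep //; case: eqP => // e; rewrite e ltnn in hc.
case: b nb hc => // k; rewrite -leqNgt => nk _.
have r6 := rel_exp C.
by rewrite /= -(subnK nk) exprD r6 mulr0 mul0r cf0.
Qed.

Lemma filt_ev v k x : filt k x -> filt k (ev v * x).
Proof. by move=> hx b hb; rewrite cf_idM // hx // mulr0. Qed.

Lemma filt_rep_mul b k x : filt k x -> filt (nlen b + k) (rep b * x).
Proof.
move=> hx; case: b => [m| | | | | | | | |]; rewrite /rep -?mulrA;
  try by repeat first [exact: filt_ev | apply: filt_arr].
elim: m => [|m IH]; first by rewrite mul1r; exact: filt_ev.
by rewrite exprS -mulrA; exact: filt_arr.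
Qed.

Lemma filtM j k x y : filt j x -> filt k y -> filt (j + k) (x * y).
Proof.
move=> hx hy; rewrite (alg_expand x) mulr_suml; apply: filt_sum => b _.
have [bj|jb] := ltnP (nlen b) j.
  by rewrite hx // sc0 !mul0r; exact: filt0.
rewrite -mulrA; apply: filt_sc; apply: filt_le (@filt_rep_mul b _ _ hy).
by rewrite leq_add2r.
Qed.

(** Terms of x containing an arrow push y into paths longer than b, so only the idempotent part of x
    at the end of b acts. This is the triangularity behind the upper bounds. *)
Lemma cf_lead b x y : (forall c, (nlen c < nlen b)%N -> cf c y = 0) ->
  cf b (x * y) = cf (nid (ntgt b)) x * cf b y.
Proof.
move=> hy; elim/alg_ind: x => [|c x x' IH IH'|v|a x IH].
- by rewrite mul0r !cf0 // mul0r.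
- by rewrite mulrDl -mulrA !(cfD, cf_sc) // IH IH' mulrDl mulrA.
- by rewrite cf_idM // cf_id // nid_eq.
rewrite -mulrA cf_arrM //; case e: lpre => [c|] /=; last first.
  rewrite cf_arrM //; case: (ntgt b) => /=; case: a {e} => //=; by rewrite mul0r.
have [_ _ _ h] := lact_some (proj2 (lactP n a c b) e).
have -> : cf c (x * y) = 0.
  by apply: (@filtM 0 (nlen b) x y) => //; rewrite h.
rewrite cf_arrM //; case: (ntgt b) => /=; case: a {e} => //=; by rewrite mul0r.
Qed.

End Basis.

Definition algA_coordinates (K : fieldType) (n : nat) (n_gt1 : (1 < n)%N) :
  coordinates K n (idem K n).
Proof.
have [[r1 r2 r3 r4 r5] r6] := relations0 K n.
by apply: (@Coordinates K n _ (idem K n) (@algA_qarr K n) (@algA_sc K n) 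
  (@algA_cf K n));
  [exact: algA_sc0 | exact: algA_sc1 | exact: algA_scD | exact: algA_scA
  | exact: algA_Msc
  | exact: algA_cfD | exact: algA_cf_sc | exact: algA_cf_arrM | exact: algA_cf_idM
  | exact: algA_cf_Mid | exact: algA_cf_id | exact: algA_ind | exact: algA_id_id
  | exact: algA_id_arr | exact: algA_arr_id | | | | | | ].
Qed.

(** * The modules P_i/Rad^j P_i *)

Section Trunc.
Variables (K : fieldType) (n : nat) (A : pzRingType) (ev : Qvertex -> A).
Hypothesis n_gt1 : (1 < n)%N.
Variable C : coordinates K n ev.
Local Notation qarr := (qarr C).
Local Notation sc := (sc C).
Local Notation cf := (cf C).
Local Notation filt := (filt C).
Local Notation rep := (rep C).

(** Nonzero paths are powers of ε of length below n or have length at most 2, so n + 2 is a crude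
    common bound. *)
Lemma filt_big x : filt n.+2 x -> x = 0.
Proof.
move=> hx; apply: (cf_sep n_gt1 (C := C)) => b; rewrite cf0.
have [vb|/(cf_invalid n_gt1)->//] := boolP (valid n b); apply: hx.
by case: b vb => //= [k kn|_|_|_]; rewrite !ltnS ltnW // ltnW.
Qed.

Lemma filt_exp x k : filt 1 x -> filt k (x ^+ k).
Proof.
move=> hx; elim: k => [|k IH] //; rewrite exprS -add1n.
exact: filtM.
Qed.

Lemma filt_arr1 a : filt 1 (qarr a).
Proof. by rewrite -[qarr a]mulr1; exact: filt_arr. Qed.

(** Multiplying by a path moves the coefficient at its source idempotent to the path itself, so an
    annihilating path forces that coefficient to vanish. *)
Lemma cf_rep_mul b x : valid n b -> cf b (rep b * x) = cf (nid (nsrc b)) x.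
Proof.
case: b => [k| | | | | | | | |] /=; last first.
1-9: by rewrite -?mulrA; do 2?rewrite cf_arrM /=; rewrite cf_idM eqxx mul1r.
rewrite -mulrA; elim: k => [|k IH] hk; first by rewrite mul1r cf_idM eqxx mul1r.
by rewrite exprS -mulrA cf_arrM /= hk /= IH // ltnW.
Qed.

Local Notation P i := (proj_indec ev i).

Lemma ev_idem i : ev i * ev i = ev i.
Proof. by rewrite (id_id C) eqxx. Qed.

Lemma mkP_subproof i (x : A) : (x * ev i : A^o) \in Ae_pred ev i.
Proof. by apply/asboolP; exists x. Qed.

Definition mkP i (x : A) : P i := Sub (x * ev i : A^o) (mkP_subproof i x).

Lemma val_mkP i x : val (mkP i x) = x * ev i.
Proof. exact: SubK. Qed.

Lemma val_ev i (z : P i) : (val z : A) * ev i = val z.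
Proof. by case: z => x /= /asboolP[a ->]; rewrite -mulrA ev_idem. Qed.

Lemma mkP_val i (z : P i) : mkP i (val z) = z.
Proof. by apply: val_inj; rewrite val_mkP; exact: val_ev. Qed.

Lemma valZ i a (z : P i) : val (a *: z) = a * (val z : A).
Proof.
have := linearP (val : {linear submod (Ae_pred ev i) -> A^o}) a z 0.
by rewrite !addr0.
Qed.

Lemma valD i (y z : P i) : val (y + z) = (val y : A) + val z.
Proof. exact: (raddfD (val : {linear submod (Ae_pred ev i) -> A^o})). Qed.

Lemma mkPZ i a x : mkP i (a * x) = a *: mkP i x.
Proof. by apply: val_inj; rewrite valZ !val_mkP mulrA. Qed.

Lemma mkPD i x y : mkP i (x + y) = mkP i x + mkP i y.
Proof. by apply: val_inj; rewrite valD !val_mkP mulrDl. Qed.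

Lemma mkP0 i : mkP i 0 = 0.
Proof. by apply: (@addrI _ (mkP i 0)); rewrite -mkPD !addr0. Qed.

Lemma cf_val i (z : P i) b : nsrc b != i -> cf b (val z) = 0.
Proof. by move=> ne; rewrite -val_ev cf_Mid (negPf ne) mul0r. Qed.

Lemma rad_pow_filt i j (z : P i) : z \in rad_pow (P i) j -> filt j (val z).
Proof.
move=> hz b; apply: (rad_pow_filtration (sc := sc) (w := nlen)
  (c := fun b (z : P i) => cf b (val z)) _ _ _ hz) => {z hz b}.
- by move=> b x y; rewrite valD cfD.
- by move=> b a x; rewrite valZ cf_sc.
move=> b r x lo bx; rewrite valZ cf_lead // bx mulr0 //.
Qed.

(** Each factor s a has positive length, so its power n + 2 is zero and [nil_mem_rad] applies. *)
Lemma rad_pow_arr i j a (z : P i) :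
  z \in rad_pow (P i) j -> qarr a *: z \in rad_pow (P i) j.+1.
Proof.
move=> hz; apply: nil_mem_rad => // s; exists n.+2.
apply: val_inj; rewrite valZ; apply: filt_big.
apply: (@filt_le _ _ _ _ C n.+2 (n.+2 + 0)); first by rewrite addn0.
apply: filtM => //; apply: filt_exp.
by apply: (@filtM _ _ _ _ n_gt1 _ 0 1) => //; exact: filt_arr1.
Qed.

Lemma rad_pow_rep b i : mkP i (rep b) \in rad_pow (P i) (nlen b).
Proof.
case: b => [k| | | | | | | | |]; rewrite /rep /nlen; do 2?rewrite mkPZ; last first.
1-9: do 2?[apply: rad_pow_arr] => //.
elim: k => [|k IH] //; rewrite exprS -scalerA.
exact: rad_pow_arr.
Qed.

(** One inclusion is the ranked-coordinate principle with path length as rank; for the other, each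
    arrow of a basis path descends one radical layer. *)
Lemma rad_powP i j (z : P i) : z \in rad_pow (P i) j <-> filt j (val z).
Proof.
split=> [|hz]; first exact: rad_pow_filt.
rewrite -[z]mkP_val (alg_expand n_gt1 C (val z)).
elim: (bs n) => [|b s IH]; first by rewrite big_nil mkP0 rpred0.
rewrite big_cons mkPD rpredD // mkPZ.
have [jb|bj] := leqP j (nlen b); first by
  rewrite rpredZ // (rad_pow_anti jb) ?rad_pow_rep.
by rewrite hz // sc0 scale0r rpred0.
Qed.

Lemma rad_vanishesP i j :
  rad_vanishes (P i) j <-> forall b, valid n b -> nsrc b = i -> (nlen b < j)%N.
Proof.
split=> [/asboolP h b vb bi|h]; last first.
  apply/asboolP => z /rad_powP hz; rewrite -[z]mkP_val -[RHS](mkP0 i).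
  congr (mkP i _); apply: (cf_sep n_gt1 (C := C)) => b; rewrite cf0.
  have [vb|/(cf_invalid n_gt1)->//] := boolP (valid n b).
  by have [bi|ne] := eqVneq (nsrc b) i; [apply: hz; exact: h|exact: cf_val].
rewrite ltnNge; apply/negP => jb.
have /(congr1 (fun z : P i => cf b (val z))) : mkP i (rep b) = 0.
  apply: h; apply/rad_powP; rewrite val_mkP -bi rep_ev.
  exact: filt_le jb (@filt_rep _ _ _ _ C b).
rewrite -(mkP0 i) !val_mkP mul0r cf0 -bi rep_ev cf_rep // eqxx.
by move/eqP; rewrite oner_eq0.
Qed.

Lemma LL_unique i l : (forall j, rad_vanishes (P i) j <-> (l <= j)%N) -> LL (P i) = l.
Proof.
move=> h; apply/eqP; rewrite eqn_leq LL_le ?LL_ge //; first by exists l; apply/h.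
  by move=> j jl /h; rewrite leqNgt jl.
exact/h.
Qed.

(** The candidates for the longest path from 1 are ε^(n-1) and β1α1; the latter wins only for n =
    2. *)
Lemma LL_P1 : LL (P V1) = maxn n 3.
Proof.
apply: LL_unique => j; split=> [/rad_vanishesP h|hj].
  rewrite geq_max (h NB1A1) // andbT.
  by have := h (NE n.-1); rewrite /= prednK ?leqnn ?(ltnW n_gt1) //; exact.
apply/rad_vanishesP => b vb sb; apply: leq_trans hj; rewrite leq_max.
by case: b vb sb => //= [k ->|_ _|_ _] //; rewrite orbT.
Qed.

Lemma LL_P2 : LL (P V2) = 3%N.
Proof.
apply: LL_unique => j; split=> [/rad_vanishesP h|hj]; first exact: (h NB2A2).
by apply/rad_vanishesP => b vb sb; apply: leq_trans hj; case: b vb sb.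
Qed.

Lemma LL_P3 : LL (P V3) = 3%N.
Proof.
apply: LL_unique => j; split=> [/rad_vanishesP h|hj]; first exact: (h NA2B2).
by apply/rad_vanishesP => b vb sb; apply: leq_trans hj; case: b vb sb.
Qed.

Lemma nform_of_len i m : (m < LL (P i))%N ->
  exists b, [/\ valid n b, nsrc b = i & nlen b = m].
Proof.
case: i; rewrite ?LL_P1 ?LL_P2 ?LL_P3 => hm.
- have [mn|nm] := ltnP m n; first by exists (NE m).
  (* Here n <= m < max(n, 3), which forces n = m = 2, and β1α1 has this length. *)
  have m3 : (m < 3)%N by move: hm; rewrite leq_max ltnNge nm.
  have -> : m = 2%N by apply/eqP; rewrite eqn_leq -ltnS m3 (leq_trans n_gt1).
  by exists NB1A1.
- by case: m hm => [|[|[|]]] // _; [exists NE2|exists NB1|exists NB2A2].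
by case: m hm => [|[|[|]]] // _; [exists NE3|exists NB2|exists NA2B2].
Qed.

Local Notation T i j := (trunc ev i j).

Definition tc i j (a : A) : T i j := mod_proj (rad_pow (P i) j) (mkP i a).

Lemma tcZ i j a x : tc i j (a * x) = a *: tc i j x.
Proof. by rewrite /tc mkPZ linearZ. Qed.

Lemma tcD i j x y : tc i j (x + y) = tc i j x + tc i j y.
Proof. by rewrite /tc mkPD linearD. Qed.

Lemma tc0 i j : tc i j 0 = 0.
Proof. by rewrite /tc mkP0 linear0. Qed.

Lemma tcN i j x : tc i j (- x) = - tc i j x.
Proof. by apply: (@addrI _ (tc i j x)); rewrite -tcD !subrr tc0. Qed.

Lemma tc_ev i j x : tc i j (x * ev i) = tc i j x.
Proof. by congr (mod_proj _ _); apply: val_inj; rewrite !val_mkP -mulrA ev_idem. Qed.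

Definition tlift i j (x : T i j) : A := val (repr x).

Lemma tc_lift i j (x : T i j) : tc i j (tlift x) = x.
Proof. by rewrite /tc mkP_val mod_reprK. Qed.

Lemma lift_ev i j (x : T i j) : tlift x * ev i = tlift x.
Proof. exact: val_ev. Qed.

Lemma tc_eq0 i j x : tc i j x = 0 <-> filt j (x * ev i).
Proof.
by rewrite -(tc0 i j) mod_projP mkP0 subr0 rad_powP val_mkP.
Qed.

(* The coordinates at paths of length >= j are junk, set to 0. *)
Definition ct i j b (x : T i j) : K :=
  if (nlen b < j)%N then cf b (tlift x) else 0.

Lemma ct_tc i j b a :
  ct b (tc i j a) = if (nlen b < j)%N && (nsrc b == i) then cf b a else 0.
Proof.
rewrite /ct; case: ltnP => //= bj.
have : tc i j (tlift (tc i j a) - a) = 0 by rewrite tcD tcN tc_lift subrr.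
move/tc_eq0/(_ b bj)/eqP; rewrite mulrBl lift_ev cfB subr_eq0 cf_Mid => /eqP->.
by case: eqP => _; rewrite ?mul1r ?mul0r.
Qed.

Lemma tc_ind i j (Q : T i j -> Prop) : (forall a, a * ev i = a -> Q (tc i j a)) ->
  forall x, Q x.
Proof. by move=> h x; rewrite -[x]tc_lift; apply: h; exact: lift_ev. Qed.

Lemma ct_sep i j (x y : T i j) : (forall b, ct b x = ct b y) -> x = y.
Proof.
move=> h; apply/eqP; rewrite -subr_eq0 -[x]tc_lift -[y]tc_lift -tcN -tcD.
apply/eqP/tc_eq0 => b bj; have := h b; rewrite /ct bj => e.
by rewrite mulrBl !lift_ev cfB e subrr.
Qed.

Lemma ctD i j b (x y : T i j) : ct b (x + y) = ct b x + ct b y.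
Proof.
elim/tc_ind: x => x _; elim/tc_ind: y => y _; rewrite -tcD !ct_tc cfD.
by case: ifP; rewrite ?addr0.
Qed.

Lemma ct0 i j b : ct b (0 : T i j) = 0.
Proof. by rewrite -(tc0 i j) ct_tc cf0 if_same. Qed.

Lemma ct_sum i j b (I : Type) (s : seq I) (F : I -> T i j) :
  ct b (\sum_(k <- s) F k) = \sum_(k <- s) ct b (F k).
Proof. exact: (big_morph _ (@ctD i j b) (@ct0 i j b)). Qed.

Lemma ct_sc i j b c (x : T i j) : ct b (sc c *: x) = c * ct b x.
Proof.
elim/tc_ind: x => x _; rewrite -tcZ !ct_tc cf_sc.
by case: ifP; rewrite ?mulr0.
Qed.

Lemma ct_src i j b (x : T i j) : nsrc b != i -> ct b x = 0.
Proof. by elim/tc_ind: x => x _ ne; rewrite ct_tc (negPf ne) andbF. Qed.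

Lemma ct_long i j b (x : T i j) : (j <= nlen b)%N -> ct b x = 0.
Proof. by rewrite /ct ltnNge => ->. Qed.

Lemma ct_idM i j b v (x : T i j) : ct b (ev v *: x) = (ntgt b == v)%:R * ct b x.
Proof.
elim/tc_ind: x => x _; rewrite -tcZ !ct_tc cf_idM.
by case: ifP; rewrite ?mulr0.
Qed.

Lemma ct_arrM i j b a (x : T i j) : (nlen b < j)%N ->
  ct b (qarr a *: x) = oapp (fun c => ct c x) 0 (lpre n a b).
Proof.
move=> bj; elim/tc_ind: x => x _; rewrite -tcZ !ct_tc bj /= cf_arrM.
case e: lpre => [c|] /=; last by rewrite if_same.
have [_ _ -> h] := lact_some (proj2 (lactP n a c b) e).
by rewrite ct_tc (leq_trans _ bj) // h ltnW.
Qed.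

Lemma ct_rep_mul i j b (x : T i j) : valid n b -> (nlen b < j)%N -> nsrc b = i ->
  ct b (rep b *: x) = ct (nid (nsrc b)) x.
Proof.
move=> vb bj bi; elim/tc_ind: x => x _; rewrite -tcZ !ct_tc bj nsrc_nid bi eqxx /=.
have j0 : (nlen (nid i) < j)%N by case: (i); exact: leq_ltn_trans bj.
by rewrite cf_rep_mul // bi j0.
Qed.

Definition tfilt i j k (x : T i j) : Prop :=
  forall b, (nlen b < k)%N -> ct b x = 0.

Lemma tfilt_lift i j k (x : T i j) : tfilt k x -> filt (minn k j) (tlift x).
Proof.
by move=> h b; rewrite leq_min => /andP[bk bj]; have := h b bk; rewrite /ct bj.
Qed.

Lemma tfiltM i j k m a (x : T i j) : filt m a -> tfilt k x -> tfilt (m + k) (a *: x).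
Proof.
move=> ha /tfilt_lift hx b hb; rewrite -[x]tc_lift -tcZ ct_tc.
case: ifP => // /andP[bj _]; apply: (filtM n_gt1 ha hx).
rewrite addn_minr leq_min hb /=; exact: leq_trans (leq_addl _ _).
Qed.

Lemma tfilt_top i j k (x : T i j) : (j <= k)%N -> tfilt k x -> x = 0.
Proof.
move=> jk h; apply: ct_sep => b; rewrite ct0.
have [bj|] := ltnP (nlen b) j; last exact: ct_long.
by apply: h; exact: leq_trans jk.
Qed.

Lemma ct_lead i j b a (x : T i j) : (forall c, (nlen c < nlen b)%N -> ct c x = 0) ->
  ct b (a *: x) = cf (nid (ntgt b)) a * ct b x.
Proof.
have [bj hx|jb _] := ltnP (nlen b) j; last by rewrite !ct_long // mulr0.
rewrite -[in LHS](tc_lift x) -tcZ ct_tc bj /=.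
have [bi|ne] := eqVneq (nsrc b) i; last by rewrite ct_src // mulr0.
rewrite /ct bj; apply: (cf_lead n_gt1) => c cb.
by have := hx c cb; rewrite /ct (leq_trans cb (ltnW bj)).
Qed.

(** Right multiplication by z sends Rad^j into Rad^(j+m), hence into Rad^j', and so descends to the
    quotients. *)
Lemma rmul_hom i j i' j' m (z : A) : filt m z -> (j' <= j + m)%N ->
  exists r : hom (T i j) (T i' j'), forall a, r (tc i j a) = tc i' j' (a * ev i * z).
Proof.
move=> hz jm; pose r (x : T i j) : T i' j' := tc i' j' (tlift x * z).
have rE a : r (tc i j a) = tc i' j' (a * ev i * z).
  apply/eqP; rewrite -subr_eq0 -tcN -tcD -mulrBl; apply/eqP/tc_eq0.
  have h : filt j (tlift (tc i j a) - a * ev i).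
    rewrite -lift_ev -mulrBl; apply/tc_eq0.
    by rewrite tcD tcN tc_lift subrr.
  rewrite -[_ * ev i']addr0; apply: (@filt_le _ _ _ _ C j' (j + m + 0)).
    by rewrite addn0.
  by rewrite addr0; apply: filtM => //; apply: filtM.
have lr : linear r.
  move=> a x y; elim/tc_ind: x => x _; elim/tc_ind: y => y _.
  by rewrite -tcZ -tcD !rE -tcZ -tcD !mulrDl !mulrA.
by exists (HB.pack r (GRing.isLinear.Build _ _ _ _ r lr) : {linear T i j -> T i' j'}).
Qed.

End Trunc.

(** * Maps out of G and their coordinates *)

Lemma homZ (A : pzRingType) (X Y : lmodType A) (f : hom X Y) a x :
  f (a *: x) = a *: f x.
Proof. exact: linearZ. Qed.

Lemma hom_sum (A : pzRingType) (X Y : lmodType A) (f : hom X Y) (J : Type)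
    (s : seq J) (F : J -> X) :
  f (\sum_(k <- s) F k) = \sum_(k <- s) f (F k).
Proof. exact: (raddf_sum (hom_fun f)). Qed.

Section HomG.
Variables (K : fieldType) (n : nat) (A : pzRingType) (ev : Qvertex -> A).
Hypothesis n_gt1 : (1 < n)%N.
Variable C : coordinates K n ev.
Local Notation qarr := (qarr C).
Local Notation sc := (sc C).
Local Notation cf := (cf C).
Local Notation filt := (filt C).
Local Notation rep := (rep C).
Local Notation ct b x := (ct C b x).
Local Notation tfilt k x := (tfilt C k x).
Local Notation P i := (proj_indec ev i).
Local Notation I := (ADR_index ev).
Implicit Types s t : I.

Definition tr (t : I) : lmodType A := trunc ev (tag t) (tagged t).+1.
Local Notation G := (ADR_gen ev).
Local Notation R := (ADR ev).

Definition prj_fun (t : I) (g : G) : tr t := g t.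
Lemma prj_linear (t : I) : linear (prj_fun t). Proof. by []. Qed.
HB.instance Definition _ (t : I) :=
  GRing.isLinear.Build A G (tr t) _ (prj_fun t) (prj_linear t).
Definition prj (t : I) : hom G (tr t) := (prj_fun t : {linear G -> tr t}).

Definition inj_fun (t : I) (x : tr t) : G := dfwith (fun s : I => 0 : tr s) x.
Lemma inj_linear (t : I) : linear (@inj_fun t).
Proof.
move=> a x y; apply: functional_extensionality_dep => s.
have [e|ne] := eqVneq t s; first by subst s; rewrite /inj_fun dfwith_in
  -[RHS]/(a *: dfwith _ x t + dfwith _ y t) !dfwith_in.
rewrite /inj_fun dfwith_out // -[RHS]/(a *: dfwith _ x s + dfwith _ y s).
by rewrite !dfwith_out // scaler0 addr0.
Qed.
HB.instance Definition _ (t : I) :=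
  GRing.isLinear.Build A (tr t) G _ (@inj_fun t) (@inj_linear t).
Definition inj (t : I) : hom (tr t) G := (@inj_fun t : {linear tr t -> G}).

Lemma injK t : cancel (inj t) (prj t).
Proof. by move=> x; rewrite /prj /inj /hom_fun /= /prj_fun /inj_fun dfwith_in. Qed.

Lemma dsumE (t : I) (s : seq I) (F : I -> G) :
  (\sum_(k <- s) F k) t = \sum_(k <- s) F k t.
Proof. by elim: s => [|k s IH]; rewrite ?big_nil // !big_cons -IH. Qed.

Lemma dsum_decomp (g : G) : g = \sum_t inj t (g t).
Proof.
apply: functional_extensionality_dep => t; rewrite dsumE (bigD1 t) //=.
rewrite [X in _ = X + _](_ : _ = g t); last exact: injK.
rewrite big1 ?addr0 // => s ne.
by rewrite /inj /hom_fun /= /inj_fun dfwith_out.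
Qed.

Definition gen (t : I) : tr t := tc ev _ _ 1.

Lemma genE t (x : tr t) : x = tlift (x : trunc _ _ _) *: gen t.
Proof. by rewrite /gen -tcZ mulr1 (tc_lift C). Qed.

Section Target.
Variable X : lmodType A.
Implicit Type f : hom G X.

(** Each summand of G is cyclic, so these values determine f; [comp_ev] and [comp_kill] record the
    constraints that the summand P_i/Rad^j P_i imposes on them. *)
Definition comp f (t : I) : X := f (inj t (gen t)).

Lemma homE f g : f g = \sum_t tlift (g t : trunc _ _ _) *: comp f t.
Proof.
rewrite {1}[g]dsum_decomp hom_sum; apply: eq_bigr => t _.
by rewrite {1}[g t]genE homZ homZ.
Qed.

Lemma hom_sep f h : (forall t, comp f t = comp h t) -> f = h.
Proof.
by move=> e; apply: homP => g; rewrite !homE; apply: eq_bigr => t _; rewrite e.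
Qed.

Lemma comp_ev f t : ev (tag t) *: comp f t = comp f t.
Proof.
rewrite /comp -2!homZ.
by rewrite /gen -tcZ mulr1 -[tc ev _ _ 1](tc_ev C) mul1r.
Qed.

Lemma comp_kill f t a : filt (tagged t).+1 a -> a *: comp f t = 0.
Proof.
move=> ha; rewrite /comp -2!homZ.
rewrite /gen -tcZ mulr1 (_ : tc ev _ _ a = 0) ?linear0 //.
apply/(tc_eq0 n_gt1 C); rewrite -[_.+1]addn0.
exact: (filtM n_gt1).
Qed.

Lemma comp_scale (r : R) f t :
  comp (r *: f) t =
    \sum_s tlift ((r : endo G) (inj t (gen t)) s : trunc _ _ _) *: comp f s.
Proof. exact: (homE f ((r : endo G) (inj t (gen t)))). Qed.

End Target.

Lemma ct_comp_tgt i j (f : hom G (trunc ev i j)) t b :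
  ntgt b != tag t -> ct b (comp f t) = 0.
Proof.
by move=> /eqP ne; rewrite -comp_ev (ct_idM n_gt1); case: eqP => // _; rewrite mul0r.
Qed.

(* A map between truncations of the same P_i that increases the length is not
   surjective. *)
Lemma comp_nonsurj (r : endo G) s t : tag s = tag t ->
  (tagged t < tagged s)%N ->
  cf (nid (tag s)) (tlift (r (inj t (gen t)) s : trunc _ _ _)) = 0.
Proof.
move=> est ts; set y := r (inj t (gen t)) s.
have [b [vb bs bl]] : exists b, [/\ valid n b, nsrc b = tag s & nlen b = (tagged t).+1].
  by apply: (nform_of_len n_gt1 C); exact: leq_ltn_trans (ltn_ord (tagged s)).
have e : rep b *: y = 0.
  rewrite -[y]/(comp (hom_comp (prj s) r) t).
  by apply: comp_kill; rewrite -bl; exact: filt_rep.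
have := ct_tc n_gt1 C (tag s) (tagged s).+1 b (rep b * tlift y).
rewrite tcZ (tc_lift C) e (ct0 n_gt1) bl ltnS ts bs eqxx /= cf_rep_mul // bs.
by [].
Qed.

(** A component of r f is a combination of components of f. By [ct_lead] only idempotent
    coefficients matter at b, and by [comp_nonsurj] these vanish for summands of the same P_i longer
    than t. *)
Lemma ct_scale i j (r : R) (f : hom G (trunc ev i j)) t b :
  (forall s c, (nlen c < nlen b)%N -> ct c (comp f s) = 0) ->
  (forall s, tag s = tag t -> (tagged s <= tagged t)%N -> ct b (comp f s) = 0) ->
  ct b (comp (r *: f) t) = 0.
Proof.
move=> lo hb; have [bt|ne] := eqVneq (ntgt b) (tag t); last exact: ct_comp_tgt.
rewrite comp_scale (ct_sum n_gt1) big1 // => s _; rewrite (ct_lead n_gt1); last first.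
  by move=> c; exact: lo.
have [st|ne] := eqVneq (tag s) (tag t); last first.
  by rewrite ct_comp_tgt ?mulr0 // bt eq_sym.
have [le|lt] := leqP (tagged s) (tagged t); first by rewrite hb // mulr0.
by rewrite bt -st comp_nonsurj // mul0r.
Qed.

Lemma scalar_linear c : linear (fun g : G => sc c *: g).
Proof. by move=> a x y; rewrite scalerDr !scalerA (Msc C). Qed.

Definition scalar (c : K) : R :=
  (HB.pack (fun g : G => sc c *: g)
    (GRing.isLinear.Build _ _ _ _ _ (scalar_linear c)) : {linear G -> G}).

Lemma compD (X : lmodType A) (f h : hom G X) t : comp (f + h) t = comp f t + comp h t.
Proof. by []. Qed.

Lemma comp_scalar (X : lmodType A) c (f : hom G X) t :
  comp (scalar c *: f) t = sc c *: comp f t.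
Proof. exact: homZ. Qed.

(* A ranking of the coordinates of Hom(G, X) (those outside S vanish
   identically) that puts shorter paths and smaller truncations first bounds the
   radical layers of any module isomorphic to Hom(G, X). *)
Lemma rad_pow_rank i j (S : I -> nform -> Prop) (rk : I -> nform -> nat)
    (V : lmodType R) (th : {linear V -> hom G (trunc ev i j)}) :
  (forall f t b, ~ S t b -> ct b (comp (f : hom G (trunc ev i j)) t) = 0) ->
  (forall s t b c, S s c -> S t b -> (nlen c < nlen b)%N -> (rk s c < rk t b)%N) ->
  (forall s t b, S s b -> S t b -> (tagged s < tagged t)%N -> (rk s b < rk t b)%N) ->
  forall k x, x \in rad_pow V k ->
    forall t b, S t b -> (rk t b < k)%N -> ct b (comp (th x) t) = 0.
Proof.
move=> hS rk1 rk2 k x hx t b Stb rtb.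
pose c (i : {tb : I * nform | S tb.1 tb.2}) (x : V) : K :=
  ct (sval i).2 (comp (th x) (sval i).1).
pose w (i : {tb : I * nform | S tb.1 tb.2}) := rk (sval i).1 (sval i).2.
have cD i' y z : c i' (y + z) = c i' y + c i' z.
  by rewrite /c linearD compD (ctD n_gt1).
have cZ i' a y : c i' (scalar a *: y) = a * c i' y.
  by rewrite /c linearZ comp_scalar (ct_sc n_gt1).
have cR i' (r : R) y : (forall j', (w j' < w i')%N -> c j' y = 0) ->
    c i' y = 0 -> c i' (r *: y) = 0.
  case: i' => -[t' b'] Stb'; rewrite /c /= => lo ctb.
  rewrite linearZ; apply: ct_scale => [s c' cb|s st].
    have [Ss|] := pselect (S s c'); last exact: hS.
    by apply: (lo (exist _ (s, c') Ss)); exact: rk1.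
  rewrite leq_eqVlt => /orP[/eqP e|lt]; last first.
    have [Ss|] := pselect (S s b'); last exact: hS.
    by apply: (lo (exist _ (s, b') Ss)); exact: rk2.
  suff -> : s = t' by [].
  case: s t' st e {Stb' lo ctb} => [v a] [v' a'] /= st e; subst v'.
  by congr existT; apply: val_inj.
exact: (rad_pow_filtration cD cZ cR hx (i := exist _ (t, b) Stb) rtb).
Qed.

Lemma hom_ct_sep i j (f : hom G (trunc ev i j)) :
  (forall t b, ct b (comp f t) = 0) -> f = 0.
Proof.
move=> h; apply: hom_sep => t; apply: (ct_sep n_gt1 (C := C)) => b.
by rewrite h [comp 0 t](_ : _ = 0) ?ct0.
Qed.

(** A map into the radical of [tr t] induces an endomorphism of G each application of which moves
    one radical layer down, so it is nilpotent on the generator [prj t]. *)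
Lemma superfluous_rad t (N : {pred hom G (tr t)}) :
  (forall f, f \in N -> forall g, tfilt 1 (f g)) ->
  superfluous (N : {pred (hom G (tr t) : lmodType R)}).
Proof.
move=> hN; apply: (superfluous_cyclic (p := prj t)).
  by move=> f; exists (hom_comp (inj t) f : endo G); exact: hom_gen (@injK t) f.
move=> f /hN hf.
exists (hom_comp (inj t) f : endo G), (tagged t).+1; split.
  exact: hom_gen (@injK t) f.
suff h m : forall g,
    tfilt m (((hom_comp (inj t) f : R) ^+ m *: (prj t : hom G (tr t))) g).
  by apply: homP => g; exact: (tfilt_top n_gt1 (leqnn _) (h _ g)).
have step (p : hom G (tr t)) k : (forall g, tfilt k (p g)) ->
    forall g, tfilt k.+1 (((hom_comp (inj t) f : R) *: p) g).
  move=> hp g; rewrite -[_ g]/(p (inj t (f g))) [f g]genE !homZ.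
  rewrite -[k.+1]/(1 + k)%N; apply: (tfiltM n_gt1); last exact: hp.
  by have := tfilt_lift (hf g); rewrite minnSS min0n.
elim: m => [|m IH] g //.
by rewrite exprS -scalerA; exact: step.
Qed.

End HomG.

(** * The minimal resolution of M *)

Section Resolution.
Variables (K : fieldType) (n : nat) (A : pzRingType) (ev : Qvertex -> A).
Hypothesis n_gt1 : (1 < n)%N.
Variable C : coordinates K n ev.
Local Notation qarr := (qarr C).
Local Notation sc := (sc C).
Local Notation cf := (cf C).
Local Notation filt := (filt C).
Local Notation rep := (rep C).
Local Notation ct b x := (ct C b x).
Local Notation tfilt k x := (tfilt C k x).
Local Notation P i := (proj_indec ev i).
Local Notation I := (ADR_index ev).
Local Notation G := (ADR_gen ev).
Local Notation R := (ADR ev).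
Local Notation tc i j := (tc ev i j).
Local Notation X33 := (trunc ev V3 3).
Local Notation X22 := (trunc ev V2 2).
Implicit Types s t : I.

(** The second entry counts from 0: [k] stands for P_v/Rad^(k+1) P_v, so [t33] has k = 2 and [t22]
    has k = 1. *)
Definition idx v k (h : (k < LL (P v))%N) : I := existT _ v (Ordinal h).

Lemma lt33 : (2 < LL (P V3))%N. Proof. by rewrite (LL_P3 n_gt1 C). Qed.
Lemma lt22 : (1 < LL (P V2))%N. Proof. by rewrite (LL_P2 n_gt1 C). Qed.
Lemma lt1 k : (k < n)%N -> (k < LL (P V1))%N.
Proof. by move=> kn; rewrite (LL_P1 n_gt1 C) leq_max kn. Qed.

Local Notation t33 := (idx lt33).
Local Notation t22 := (idx lt22).

Definition pi33 : hom G X33 := prj t33.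
Definition pi22 : hom G X22 := prj t22.
Definition io33 : hom X33 G := inj t33.
Definition io22 : hom X22 G := inj t22.

Lemma io33K : cancel io33 pi33. Proof. exact (@injK _ ev t33). Qed.
Lemma io22K : cancel io22 pi22. Proof. exact (@injK _ ev t22). Qed.

Lemma ct_srcP i j b (x : trunc ev i j) : nsrc b <> i -> ct b x = 0.
Proof. by move/eqP; exact: ct_src. Qed.

(** * The maps φ and ψ *)

Definition phi : hom X33 X33 :=
  sval (cid (rmul_hom n_gt1 V3 (j := 3) V3 (j' := 3) (m := 2)
    (@filt_rep _ _ _ _ C NA2B2) isT)).
Lemma phiE a : phi (tc V3 3 a) = tc V3 3 (a * ev V3 * rep NA2B2).
Proof. by rewrite /phi; case: cid. Qed.

(** Multiplication by β2 adds one to lengths, so Rad^2 P_2 goes to Rad^3 P_3 = 0; the bound 3 <= 2 +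
    1 is tight. *)
Definition psi : hom X22 X33 :=
  sval (cid (rmul_hom n_gt1 V2 (j := 2) V3 (j' := 3) (m := 1)
    (@filt_rep _ _ _ _ C NB2) isT)).
Lemma psiE a : psi (tc V2 2 a) = tc V3 3 (a * ev V2 * rep NB2).
Proof. by rewrite /psi; case: cid. Qed.

Lemma hom_inj_tc (X : lmodType A) (f : hom G X) t a :
  f (inj t (tc (tag t) (tagged t).+1 a)) = a *: comp f t.
Proof.
have e : a *: gen t = tc (tag t) (tagged t).+1 a.
  by rewrite /gen -[LHS]tcZ mulr1.
by rewrite /comp -2!homZ e.
Qed.

Lemma ev_repE b v : ntgt b = v -> ev v * rep b = rep b.
Proof. by move=> <-; exact: ev_rep. Qed.

Lemma ct_phi x : ct NA2B2 (phi x) = ct NE3 x.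
Proof.
elim/(tc_ind C): x => a ea; rewrite phiE -mulrA ev_repE // tcZ (ct_lead n_gt1).
  by rewrite !(ct_tc n_gt1) cf_rep //= !eqxx mulr1.
by move=> c hc; rewrite (ct_tc n_gt1) filt_rep // if_same.
Qed.

Lemma ct_psi x : ct NB2 (psi x) = ct NE2 x.
Proof.
elim/(tc_ind C): x => a ea; rewrite psiE -mulrA ev_repE // tcZ (ct_lead n_gt1).
  by rewrite !(ct_tc n_gt1) cf_rep //= !eqxx mulr1.
by move=> c hc; rewrite (ct_tc n_gt1) filt_rep // if_same.
Qed.

Lemma phi_eq0 x : phi x = 0 <-> tfilt 1 x.
Proof.
split=> [e b|h].
  case: b => [[|k]| | | | | | | | |] //= _.
  - by rewrite ct_srcP.
  - by rewrite ct_srcP.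
  by rewrite -ct_phi e (ct0 n_gt1).
rewrite -(tc_lift C x) phiE -mulrA ev_repE //; apply/(tc_eq0 n_gt1 C).
apply: (@filt_le _ _ _ _ C 3 (1 + 2 + 0)) => //.
apply: (filtM n_gt1) => //; apply: (filtM n_gt1).
  by have := tfilt_lift h.
exact: (@filt_rep _ _ _ _ C NA2B2).
Qed.

Lemma phi_psi x : phi (psi x) = 0.
Proof.
apply/phi_eq0; rewrite -(tc_lift C x) psiE -mulrA ev_repE // tcZ.
apply: (@tfiltM _ _ _ _ n_gt1 C V3 3 1 0) => // b hb.
by rewrite (ct_tc n_gt1) filt_rep // if_same.
Qed.

(** * The socle of P_3 and the submodule L_{3,3} *)

Definition w33 : X33 := tc V3 3 (rep NA2B2).

Lemma ct_w33 b : ct b w33 = (b == NA2B2)%:R.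
Proof.
rewrite (ct_tc n_gt1) cf_rep //; case: (b =P _) => [->|_]; last by rewrite if_same.
by rewrite /= eqxx.
Qed.

Lemma w33_neq0 : w33 != 0.
Proof.
apply/eqP => /(congr1 (fun x => ct NA2B2 x)); rewrite ct_w33 eqxx (ct0 n_gt1).
by move/eqP; rewrite oner_eq0.
Qed.

Lemma tfilt2_33 (x : X33) : tfilt 2 x -> x = sc (ct NA2B2 x) *: w33.
Proof.
move=> h; apply: (ct_sep n_gt1 (C := C)) => b; rewrite (ct_sc n_gt1) ct_w33.
have [->|ne] := eqVneq b NA2B2; first by rewrite mulr1.
rewrite mulr0; have [b3|ne3] := eqVneq (nsrc b) V3; last exact: ct_src.
by apply: h; case: b ne b3 => //=; case/eqP.
Qed.

Lemma tfilt_w33 : tfilt 2 w33.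
Proof. by move=> b; rewrite ct_w33; case: eqP => // ->. Qed.

Lemma cyclic_w33 x : x \in cyclic w33 <-> tfilt 2 x.
Proof.
split=> [/cyclicP[r ->]|/tfilt2_33->].
  by apply: (@tfiltM _ _ _ _ n_gt1 C V3 3 2 0) => //; exact: tfilt_w33.
by apply/cyclicP; exists (sc (ct NA2B2 x)).
Qed.

Lemma sc_unscale c (x y : X33) : c != 0 -> x = sc c *: y -> y = sc c^-1 *: x.
Proof. by move=> c0 ->; rewrite scalerA -(scA C) mulVf // (sc1 C) scale1r. Qed.

(** P_3 is uniserial with basis e_3, β2, α2β2: according to the first nonzero coordinate of x, one
    of α2β2, α2, 1 carries x to a nonzero multiple of [w33]. *)
Lemma soc33 : soc (@full_mod _ X33) =i cyclic w33.
Proof.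
apply: soc_cyclic => //; first exact: w33_neq0.
move=> x _ x0.
have main a : tfilt 2 (a *: x) -> ct NA2B2 (a *: x) != 0 -> exists r, w33 = r *: x.
  move=> /tfilt2_33 e c0; exists (sc (ct NA2B2 (a *: x))^-1 * a).
  by rewrite -scalerA; exact: sc_unscale.
have [e0|e0] := eqVneq (ct NE3 x) 0; last first.
  apply: (main (rep NA2B2)); last by rewrite (ct_rep_mul n_gt1).
  by apply: (@tfiltM _ _ _ _ n_gt1 C V3 3 0 2) => //;
    exact: (@filt_rep _ _ _ _ C NA2B2).
have x1 : tfilt 1 x.
  by case=> [[|k]| | | | | | | | |] //= _; first [exact: e0 | exact: ct_srcP].
have [b0|b0] := eqVneq (ct NB2 x) 0; last first.
  apply: (main (qarr Alpha2)); last by rewrite (ct_arrM n_gt1).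
  by apply: (@tfiltM _ _ _ _ n_gt1 C V3 3 1 1) => //; exact: filt_arr1.
have x2 : tfilt 2 x.
  move=> b hb; have [b3|ne3] := eqVneq (nsrc b) V3; last exact: ct_src.
  by case: b hb b3.
apply: (main 1); rewrite scale1r //; apply: contra x0 => /eqP c0.
by rewrite (tfilt2_33 x2) c0 (sc0 C) scale0r.
Qed.

Lemma tagged_V3 t : tag t = V3 -> (tagged t <= 2)%N.
Proof.
case: t => v k /= e; subst v; rewrite -ltnS.
by have := ltn_ord k; rewrite {2}(LL_P3 n_gt1 C).
Qed.

Lemma tagged_V2 t : tag t = V2 -> (tagged t <= 2)%N.
Proof.
case: t => v k /= e; subst v; rewrite -ltnS.
by have := ltn_ord k; rewrite {2}(LL_P2 n_gt1 C).
Qed.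

Local Notation P33 := (hom G X33 : lmodType R).
Local Notation P22 := (hom G X22 : lmodType R).

Definition L33_sub : submodClosed P33 := soc (hom_in G (soc (@full_mod _ X33))).

Definition u33 : hom G X33 := hom_comp phi pi33.


Lemma tgen_phi : phi (tc V3 3 1) = w33.
Proof. by rewrite phiE mul1r ev_repE. Qed.

Lemma u33_neq0 : (u33 : P33) != 0.
Proof.
apply/eqP => /(congr1 (fun f : hom G X33 => f (io33 (tc V3 3 1)))).
rewrite /u33 -[LHS]/(phi (pi33 (io33 (tc V3 3 1)))) io33K tgen_phi => e.
by move: w33_neq0; rewrite e eqxx.
Qed.

(** A nonzero map from G into the socle of P_3 is nonzero on some summand P_3/Rad^j P_3, and
    composing with P_3 → P_3/Rad^j P_3 recovers [u33]. *)
Lemma L33E : L33_sub =i cyclic (u33 : P33).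
Proof.
apply: soc_cyclic.
- apply/asboolP => g; rewrite soc33; apply/cyclic_w33.
  rewrite -[u33 g]/(phi (pi33 g)) -(tc_lift C (pi33 g)) phiE -mulrA ev_repE // tcZ.
  by apply: (@tfiltM _ _ _ _ n_gt1 C V3 3 2 0) => //; exact: tfilt_w33.
- exact: u33_neq0.
move=> f /asboolP hf f0.
have hf' g : tfilt 2 (f g) by apply/cyclic_w33; rewrite -soc33; exact: hf.
have [t ft] : exists t, comp f t != 0.
  apply: contrapT => no; case/eqP: f0; apply: (hom_sep C) => t.
  by apply: contrapT => /eqP ft; apply: no; exists t.
have fE : comp f t = sc (ct NA2B2 (comp f t)) *: w33 := tfilt2_33 (hf' _).
set c := ct NA2B2 (comp f t) in fE.
have c0 : c != 0.
  by apply: contra ft => /eqP c0; rewrite fE c0 (sc0 C) scale0r.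
have tV3 : tag t = V3.
  have [//|ne] := eqVneq (tag t) V3; case/eqP: c0.
  by apply: (ct_comp_tgt n_gt1); rewrite eq_sym.
have le3 : ((tagged t).+1 <= 3 + 0)%N by rewrite addn0 ltnS; exact: tagged_V3.
have f1 : filt 0 (sc c^-1) by [].
(* The canonical projection, scaled by the inverse of c so that f after it gives [u33] exactly. *)
have [q qE] := rmul_hom n_gt1 V3 (j := 3) (tag t) f1 le3.
exists (hom_comp (inj t) (hom_comp q pi33) : endo G); apply: homP => g.
rewrite -[LHS]/(phi (pi33 g)) -[RHS]/(f (inj t (q (pi33 g)))).
rewrite -(tc_lift C (pi33 g)) phiE qE -mulrA ev_repE // tcZ (lift_ev C).
by rewrite [RHS]hom_inj_tc fE scalerA -mulrA -(scA C) mulVf // (sc1 C) mulr1.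
Qed.

(** * The induced maps Φ, Ψ and their kernels *)

Definition Phi (f : P33) : P33 := hom_comp phi f.
Lemma Phi_linear : linear Phi.
Proof. by move=> r f h; apply: homP => g; exact: (raddfD (hom_fun phi)). Qed.
HB.instance Definition _ := GRing.isLinear.Build R P33 P33 _ Phi Phi_linear.

Definition Psi (f : P22) : P33 := hom_comp psi f.
Lemma Psi_linear : linear Psi.
Proof. by move=> r f h; apply: homP => g; exact: (raddfD (hom_fun psi)). Qed.
HB.instance Definition _ := GRing.isLinear.Build R P22 P33 _ Psi Psi_linear.

Lemma P33_projective : projective P33.
Proof. exact: (hom_projective io33K). Qed.

Lemma P22_projective : projective P22.
Proof. exact: (hom_projective io22K). Qed.

Lemma L33_Phi f : f \in L33_sub <-> exists h, f = Phi h.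
Proof.
rewrite L33E; split=> [/cyclicP[r ->]|[h ->]]; first by
  exists (r *: (pi33 : P33)); apply: homP.
apply/cyclicP; exists (hom_comp io33 h : endo G).
by rewrite {1}[h](hom_gen io33K) linearZ.
Qed.

Lemma Phi_eq0 (f : hom G X33) : Phi f = 0 <-> forall g, tfilt 1 (f g).
Proof.
split=> [e g|h]; last by apply: homP => g; apply/phi_eq0; exact: h.
by apply/phi_eq0; rewrite -[LHS]/(Phi f g) e.
Qed.

Lemma Phi_filt f g : tfilt 1 (Phi f g).
Proof.
rewrite -[Phi f g]/(phi (f g)) -(tc_lift C (f g)) phiE -mulrA ev_repE // tcZ.
apply: (@tfiltM _ _ _ _ n_gt1 C V3 3 1 0) => // b hb.
exact: (@tfilt_w33 b (leq_trans hb (isT : (1 <= 2)%N))).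
Qed.

Lemma Psi_filt (f : hom G X22) : Psi f = 0 -> forall g, tfilt 1 (f g).
Proof.
move=> e g; have h : psi (f g) = 0 by rewrite -[LHS]/(Psi f g) e.
by case=> [[|k]| | | | | | | | |] //= _;
  first [exact: ct_srcP | rewrite -ct_psi h (ct0 n_gt1)].
Qed.

Lemma hom_sumE (X : lmodType A) (J : Type) (s : seq J) (F : J -> hom G X) g :
  (\sum_(k <- s) F k) g = \sum_(k <- s) F k g.
Proof. by elim: s => [|k s IH]; rewrite ?big_nil // !big_cons -IH. Qed.

Lemma lift_Psi_comp t (x : X33) : tfilt 1 x -> ev (tag t) *: x = x ->
  (forall a, filt (tagged t).+1 a -> a *: x = 0) ->
  exists h : hom (tr t) X22, psi (h (gen t)) = x.
Proof.
move=> x1 ex kx.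
(* The lift is right multiplication by z, so x has to be written as z β2 with z deep enough to
   descend to [tr t]. *)
have [m [z [hz hm zx]]] : exists m z, [/\ filt m z, (2 <= (tagged t).+1 + m)%N &
    tc V3 3 (z * rep NB2) = x].
  have sepx y : ct NB2 y = ct NB2 x -> ct NA2B2 y = ct NA2B2 x -> tfilt 1 y -> y = x.
    move=> e1 e2 y1; apply: (ct_sep n_gt1 (C := C)) => b.
    have [b0|b0] := ltnP (nlen b) 1; first by rewrite x1 // y1.
    have [b3|ne3] := eqVneq (nsrc b) V3; last by rewrite !ct_src.
    by case: b b0 b3.
  have tgt b : ntgt b <> tag t -> ct b x = 0.
    by move=> /eqP ne; rewrite -ex (ct_idM n_gt1) (negPf ne) mul0r.
  have y1 a : tfilt 1 (tc V3 3 (a * rep NB2)).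
    rewrite tcZ; apply: (@tfiltM _ _ _ _ n_gt1 C V3 3 1 0) => // b hb.
    by rewrite (ct_tc n_gt1) (@filt_rep _ _ _ _ C NB2 b hb) if_same.
  have vcase (v : Qvertex) : [\/ v = V1, v = V2 | v = V3].
    by case: v; [constructor 1 | constructor 2 | constructor 3].
  case: (vcase (tag t)) => et.
  - exists 2%N, 0; split; [by move=> b _; rewrite cf0 | exact: leq_addl |].
    by apply: sepx => //; rewrite mul0r tc0 (ct0 n_gt1) tgt // et.
  (* At vertex 2, x is a multiple of β2. On the simple summand P_2/Rad P_2 it is killed by α2, hence
     zero, and z = 0 has any depth; on longer summands depth 0 suffices. *)
  - exists (if (tagged t == 0 :> nat)%N then 1%N else 0%N), (sc (ct NB2 x)).
    split.
    + case: eqP => // e b hb.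
      have : qarr Alpha2 *: x = 0 by apply: kx; rewrite e; exact: filt_arr1.
      move/(congr1 (fun y => ct NA2B2 y)); rewrite (ct_arrM n_gt1) //=.
      rewrite (ct0 n_gt1) => ->.
      by rewrite (sc0 C) cf0.
    + by case: (nat_of_ord _) => //= k; rewrite addn0.
    apply: sepx => //; rewrite (ct_tc n_gt1) /= eqxx cf_sc.
      by rewrite [cf _ _](@cf_rep _ _ _ _ C NB2 NB2) // eqxx mulr1.
    by rewrite [cf _ _](@cf_rep _ _ _ _ C NA2B2 NB2) // mulr0 tgt // et.
  (* At vertex 3, x is a multiple of α2β2, and α2 supplies the depth 1. *)
  exists 1%N, (sc (ct NA2B2 x) * rep NA2); split.
  + by apply: filt_sc; exact: (@filt_rep _ _ _ _ C NA2).
  + by rewrite addn1.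
  have rr : rep NA2 * rep NB2 = rep NA2B2.
    by rewrite /rep -!mulrA [ev V2 * _](ev_rep C NB2).
  apply: sepx => //; rewrite -mulrA rr (ct_tc n_gt1) /= eqxx cf_sc.
    by rewrite [cf _ _](@cf_rep _ _ _ _ C NB2 NA2B2) // mulr0 tgt // et.
  by rewrite [cf _ _](@cf_rep _ _ _ _ C NA2B2 NA2B2) // eqxx mulr1.
have [h hE] := rmul_hom n_gt1 (tag t) V2 hz hm.
exists h; rewrite -[RHS]ex -[in RHS]zx -tcZ /gen hE mul1r psiE.
by rewrite -(mulrA _ (ev V2)) (ev_rep C NB2) mulrA.
Qed.

Lemma lift_Psi (y : hom G X33) : (forall g, tfilt 1 (y g)) -> exists f, y = Psi f.
Proof.
move=> hy.
have ex t : exists h : hom (tr t) X22, psi (h (gen t)) = comp y t.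
  apply: lift_Psi_comp => [||a ha]; [exact: hy | exact: (comp_ev C) |].
  exact: (comp_kill n_gt1 _ ha).
pose h t := sval (cid (ex t)).
exists (\sum_t hom_comp (h t) (prj t)); apply: homP => g.
rewrite [LHS](homE C) -[RHS]/(psi ((\sum_t hom_comp (h t) (prj t)) g)).
rewrite hom_sumE hom_sum; apply: eq_bigr => t _.
rewrite -[hom_comp _ _ g]/(h t (g t)) {2}[g t](genE C) !homZ; congr (_ *: _).
by rewrite /h; case: cid.
Qed.

(** * A descending chain of elements in P_{2,2} *)

Lemma beta_subproof k : (2 <= k.+1 + 1)%N. Proof. by rewrite addn1. Qed.

(** The map e_1 ↦ β1; its image is a copy of L_1, as εβ1 = 0 and α1β1 lies in Rad^2 P_2. *)
Definition beta k (kn : (k < n)%N) : hom (tr (idx (lt1 kn))) X22 :=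
  sval (cid (rmul_hom n_gt1 V1 (j := k.+1) V2 (j' := 2) (m := 1)
    (@filt_rep _ _ _ _ C NB1) (beta_subproof k))).
Lemma betaE k (kn : (k < n)%N) a :
  beta kn (tc V1 k.+1 a) = tc V2 2 (a * ev V1 * rep NB1).
Proof. by rewrite /beta; case: cid. Qed.

Definition U k (kn : (k < n)%N) : hom G X22 := hom_comp (beta kn) (prj (idx (lt1 kn))).

Lemma ct_NB1 a b : ct b (tc V2 2 (a * ev V1 * rep NB1)) =
  ct b (a *: tc V2 2 (rep NB1)).
Proof. by rewrite -mulrA ev_repE // tcZ. Qed.

Lemma tfilt_NB1 : tfilt 1 (tc V2 2 (rep NB1)).
Proof. by move=> b hb; rewrite (ct_tc n_gt1) (@filt_rep _ _ _ _ C NB1) // if_same. Qed.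

Lemma U_filt k (kn : (k < n)%N) g : tfilt 1 (U kn g).
Proof.
rewrite -[U kn g]/(beta kn (g (idx (lt1 kn)))) -(tc_lift C (g _ : trunc _ _ _)) betaE.
move=> b hb; rewrite ct_NB1.
by apply: (@tfiltM _ _ _ _ n_gt1 C V2 2 1 0) => //; exact: tfilt_NB1.
Qed.

Lemma U_neq0 k (kn : (k < n)%N) : U kn != 0.
Proof.
apply/eqP => /(congr1
  (fun f : hom G X22 => ct NB1 (f (inj (idx (lt1 kn)) (tc V1 k.+1 1))))).
rewrite -[X in ct _ X = _ -> _]/(beta kn (prj _ (inj (idx (lt1 kn)) (tc V1 k.+1 1)))).
rewrite [prj _ _](@injK _ ev (idx (lt1 kn))) betaE mul1r ev_repE // (ct_tc n_gt1).
rewrite [cf _ _](@cf_rep _ _ _ _ C NB1 NB1) //= !eqxx (ct0 n_gt1).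
by move/eqP; rewrite oner_eq0.
Qed.

(** Two passages through [U n0] land in Rad^2 of P_2/Rad^2 P_2, which is zero; hence the exponent
    2. *)
Lemma U_base (n0 : (0 < n)%N) : exists r : R, U n0 = r *: (pi22 : P22) /\
  forall s : R, (s * r) ^+ 2 *: (pi22 : P22) = 0.
Proof.
exists (hom_comp io22 (U n0) : endo G); split; first exact: (hom_gen io22K).
set r : R := hom_comp _ _ => s.
have rU : U n0 = r *: (pi22 : P22) by exact: (hom_gen io22K).
have nil : r *: (s *: U n0) = 0.
  pose s' : hom G G := s.
  apply: homP => g; rewrite -[LHS]/(U n0 (s' (io22 (U n0 g)))).
  have e : U n0 g = tlift (U n0 g) *: tc V2 2 1 by rewrite -tcZ mulr1 (tc_lift C).
  rewrite e (homZ io22) (homZ s') (homZ (U n0)).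
  apply: (@tfilt_top _ _ _ _ n_gt1 C V2 2 2) => //.
  apply: (@tfiltM _ _ _ _ n_gt1 C V2 2 1 1); last exact: U_filt.
  exact: (tfilt_lift (@U_filt _ n0 g)).
by rewrite expr2 -!scalerA -rU nil scaler0.
Qed.

(** Here p comes from the projection P_1/Rad^(k+2) → P_1/Rad^(k+1). Returning through any s is not
    surjective, so it lands in the radical, which [beta kn1] kills. *)
Lemma U_step k (kn : (k < n)%N) (kn1 : (k.+1 < n)%N) :
  exists p : R, U kn1 = p *: U kn /\ forall s : R, (s * p) ^+ 2 *: U kn = 0.
Proof.
have f1 : filt 0 1 by [].
have [q qE] := rmul_hom n_gt1 V1 (j := k.+2) V1 (j' := k.+1) f1
  (leq_trans (leqnSn _) (leq_addr _ _)).
pose t := idx (lt1 kn); pose t1 := idx (lt1 kn1).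
pose p : hom G G := hom_comp (inj t) (hom_comp q (prj t1)).
have pU : U kn1 = (p : R) *: U kn.
  apply: homP => g; rewrite -[RHS]/(beta kn (prj t (inj t (q (g t1))))).
  rewrite [prj t _](@injK _ ev t) -[LHS]/(beta kn1 (g t1)).
  rewrite -(tc_lift C (g t1 : trunc _ _ _)) qE !betaE mulr1.
  by rewrite -[_ * ev V1 * ev V1]mulrA (ev_idem C).
exists p; split=> // s; pose s' : hom G G := s.
have nil : (p : R) *: (s *: U kn1) = 0.
  apply: homP => g; rewrite -[LHS]/(U kn1 (s' (inj t (q (g t1))))).
  set x := q _; have -> : x = tlift x *: (gen t : trunc ev V1 k.+1).
    by rewrite /gen -tcZ mulr1 (tc_lift C).
  rewrite (homZ (inj t)) (homZ s') (homZ (U kn1)).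
  suff -> : U kn1 (s' (inj t (gen t))) = 0 by rewrite scaler0.
  rewrite -[LHS]/(beta kn1 (s' (inj t (gen t)) t1)).
  set y := s' _ _; rewrite -(tc_lift C (y : trunc ev V1 k.+2)) betaE (lift_ev C).
  apply/(tc_eq0 n_gt1 C); apply: (@filt_le _ _ _ _ C 2 (1 + 1 + 0)) => //.
  apply: (filtM n_gt1) => //; apply: (filtM n_gt1);
    last exact: (@filt_rep _ _ _ _ C NB1).
  move=> b hb; have [bV|ne] := eqVneq (nsrc b) V1; last first.
    by rewrite -(lift_ev C) (cf_Mid C) (negPf ne) mul0r.
  (* The trivial path at 1 is the only path of length 0 from 1, so non-surjectivity settles the last
     coefficient. *)
  have -> : b = nid (tag t1) by case: b bV hb => [[|l]| | | | | | | | |].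
  exact: (comp_nonsurj n_gt1).
by rewrite expr2 -!scalerA -pU nil scaler0.
Qed.

(** * Loewy lengths of P_{3,3} and P_{2,2} *)

Lemma len_le_P t : (tagged t < maxn n 3)%N.
Proof.
apply: leq_trans (ltn_ord (tagged t)) _; case: t => -[] k /=.
- by rewrite (LL_P1 n_gt1 C).
- by rewrite (LL_P2 n_gt1 C) leq_max orbT.
by rewrite (LL_P3 n_gt1 C) leq_max orbT.
Qed.

Lemma LL_P33_le (V : lmodType R) (s : {linear P33 -> V}) (t : {linear V -> P33}) :
  cancel t s -> (LL V <= 6)%N.
Proof.
move=> tK.
(* The six surviving coordinates get ranks 0 for e_3, then 1 and 2 for β2, then 3, 4, 5 for α2β2. *)
pose S (i : I) (b : nform) : Prop :=
  match b with
  | NE3 => tag i = V3 /\ tagged i = 2%N :> nat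
  | NB2 => tag i = V2 /\ (0 < tagged i)%N
  | NA2B2 => tag i = V3
  | _ => False
  end.
pose rk (i : I) (b : nform) : nat :=
  (match b with NB2 => tagged i | NA2B2 => 3 + tagged i | _ => 0 end)%N.
have hS f i b : ~ S i b -> ct b (comp (f : hom G X33) i) = 0.
  move=> nS; have [bi|ne] := eqVneq (ntgt b) (tag i); last exact: ct_comp_tgt.
  have [b3|ne] := eqVneq (nsrc b) V3; last exact: ct_src.
  case: b bi b3 nS => //= bi _ nS; last by case: nS.
    have i2 : (tagged i < 2)%N.
      have := tagged_V3 (esym bi); rewrite leq_eqVlt => /orP[/eqP e|//].
      by case: nS.
    (* α2β2 kills P_3/Rad^j P_3 for j <= 2, so e_3 has coefficient zero there; below, α2 does the
       same for β2 on P_2/Rad P_2. *)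
    have : rep NA2B2 *: comp f i = 0.
      exact: (comp_kill n_gt1 f (filt_le i2 (@filt_rep _ _ _ _ C NA2B2))).
    move/(congr1 (fun x => ct NA2B2 x)); rewrite (ct_rep_mul n_gt1) //= (ct0 n_gt1).
    exact.
  have i0 : (tagged i < 1)%N.
    by rewrite ltnNge; apply/negP => h; apply: nS.
  have : qarr Alpha2 *: comp f i = 0.
    exact: (comp_kill n_gt1 f (filt_le i0 (@filt_arr1 _ _ _ _ C Alpha2))).
  move/(congr1 (fun x => ct NA2B2 x)); rewrite (ct_arrM n_gt1) //= (ct0 n_gt1).
  exact.
apply: LL_le; apply/asboolP => x hx; rewrite -(tK x).
suff -> : t x = 0 by rewrite linear0.
apply: (hom_ct_sep n_gt1 (C := C)) => i b.
have [Sib|] := pselect (S i b); last exact: hS.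
apply: (rad_pow_rank n_gt1 (S := S) (rk := rk) t hS _ _ hx) => //.
- move=> i1 i2 b1 b2; case: b2 => //=; case: b1 => //=.
  + by move=> _ [_ h] _.
  + by move=> [iV2 _] _ _; rewrite ltn_addr // ltnS tagged_V2.
- by move=> i1 i2 b1; case: b1 => //= -[_ ->] [_ ->].
case: b Sib => //= [[iV2 _]|iV3]; first by rewrite (leq_ltn_trans (tagged_V2 iV2)).
by rewrite (@ltn_add2l 3 _ 3) ltnS tagged_V3.
Qed.

Lemma LL_P22_ge (V : lmodType R) (s : {linear P22 -> V}) (t : {linear V -> P22}) :
  cancel s t -> cancel t s -> (1 + n <= LL V)%N.
Proof.
move=> sK tK; apply: LL_ge.
  (* Some radical power must vanish for [LL] to be meaningful. L exceeds every [tagged], so length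
     times L plus [tagged] ranks lexicographically, and lengths are below 2. *)
  pose L := maxn n 3; exists (2 * L)%N.
  apply/asboolP => x hx; rewrite -(tK x).
  suff -> : t x = 0 by rewrite linear0.
  apply: (hom_ct_sep n_gt1 (C := C)) => i b.
  have [b2|] := ltnP (nlen b) 2; last exact: (ct_long C).
  have rk1 (i' : I) b' m : (nlen b' < m)%N -> (nlen b' * L + tagged i' < m * L)%N.
    move=> h; apply: leq_trans (_ : (nlen b').+1 * L <= _)%N;
      last by rewrite leq_mul2r h orbT.
    by rewrite mulSn addnC ltn_add2r len_le_P.
  apply: (rad_pow_rank n_gt1 (S := fun _ _ => True)
    (rk := fun i b => (nlen b * L + tagged i)%N) t _ _ _ hx) => //.
  - by move=> i1 i2 b1 c _ _ h; rewrite ltn_addr // rk1.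
  - by move=> i1 i2 b1 _ _ h; rewrite ltn_add2l.
  exact: rk1.
have n0 : (0 < n)%N := ltnW n_gt1.
have Urad k (kn : (k < n)%N) : s (U kn) \in rad_pow V k.+1.
  elim: k kn => [|k IH] kn.
    have [r [-> nil]] := U_base kn; rewrite linearZ.
    by apply: nil_mem_rad => // q; exists 2%N; rewrite -linearZ nil linear0.
  have [p [-> nil]] := U_step (ltnW kn) kn; rewrite linearZ.
  apply: nil_mem_rad => // q; exists 2%N; by rewrite -linearZ nil linear0.
have Un k (kn : (k < n)%N) : s (U kn) <> 0.
  move=> e; have /eqP := U_neq0 kn; apply; apply: (can_inj sK).
  by rewrite e linear0.
(* Rad^(j+1) contains the image of U_j for j < n; together with Rad^0 this gives 1 + n nonzero
   powers. *)
case=> [|j] hj /asboolP vj; last by apply: (Un j hj); apply: vj.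
by apply: (Un 0%N n0); apply: vj.
Qed.

Lemma resolution_LL (Q : nat -> lmodType R) (d : forall i, {linear Q i.+1 -> Q i})
    (aug : {linear Q 0%N -> quot_mod L33_sub}) : min_proj_res d aug ->
  [/\ (LL (Q 1%N) <= 6)%N, (1 + n <= LL (Q 2%N))%N & exists x : Q 1%N, x != 0].
Proof.
move=> res.
have sup33 (N : {pred P33}) :
    (forall f, f \in N -> forall g, tfilt 1 ((f : hom G X33) g)) -> superfluous N.
  exact: (@superfluous_rad _ _ _ _ n_gt1 C t33).
(* Degree 0: P_{3,3} → M is a projective cover, as L_{3,3} consists of maps into the radical of
   P_3. *)
have [|||s0 [t0 [e0 s0K t0K]]] := cover_iso (f := aug)
    (g := (mod_proj L33_sub : {linear P33 -> quot_mod L33_sub}))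
    (@res_projective _ _ _ _ _ res 0%N) P33_projective _ _ (@res_min0 _ _ _ _ _ res).
- by move=> v; elim/mod_ind: (aug v) => y; exists y.
- by move=> v; exact: (res_surj res).
- apply: sup33 => f /eqP hf.
  have /L33_Phi[h ->] : f \in L33_sub.
    by rewrite -[f]subr0; apply/mod_projP; rewrite hf linear0.
  exact: Phi_filt.
have aug0 f : aug (s0 f) = 0 <-> exists h, f = Phi h.
  have m0 : mod_proj L33_sub 0 = 0 by exact: linear0.
  rewrite e0 -L33_Phi -[X in _ = X]m0 /=.
  by rewrite mod_projP subr0.
(* Degree 1: the image of [d 0] is the kernel of [aug], that is, s0 of the image of [Phi]. *)
have [|||s1 [t1 [e1 s1K t1K]]] := cover_iso (f := d 0%N)
    (g := s0 \o Phi : {linear _ -> _})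
    (@res_projective _ _ _ _ _ res 1%N) P33_projective _ _ (@res_min _ _ _ _ _ res 0%N).
- move=> v; have /aug0[h eh] : aug (s0 (t0 (d 0%N v))) = 0.
    by rewrite t0K; apply/(res_exact0 res); exists v.
  by exists h; rewrite /= -eh t0K.
- move=> f; have /(res_exact0 res)[v ev'] : aug (s0 (Phi f)) = 0.
    by apply/aug0; exists f.
  by exists v.
- apply: sup33 => f /eqP hf; apply/Phi_eq0; apply: (can_inj s0K).
  by rewrite linear0 -[RHS]hf.
have d00 (f : hom G X33) : d 0%N (s1 f) = 0 <-> forall g, tfilt 1 (f g).
  have e1f : d 0%N (s1 f) = s0 (Phi f) by exact: e1.
  split=> [h|/(proj2 (Phi_eq0 f)) h]; last by rewrite e1f h linear0.
  by apply/Phi_eq0; apply: (can_inj s0K); rewrite -e1f h linear0.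
(* Degree 2: the kernel of [d 0] corresponds to the maps into Rad P_3, which all lift along ψ. *)
have [|||s2 [t2 [e2 s2K t2K]]] := cover_iso (f := d 1%N)
    (g := s1 \o Psi : {linear _ -> _})
    (@res_projective _ _ _ _ _ res 2%N) P22_projective _ _ (@res_min _ _ _ _ _ res 1%N).
- move=> v; have h0 : d 0%N (s1 (t1 (d 1%N v))) = 0.
    by rewrite t1K; apply/(res_exact res); exists v.
  have [h eh] := @lift_Psi (t1 (d 1%N v)) (proj1 (d00 (t1 (d 1%N v))) h0).
  by exists h; rewrite -[RHS]t1K; exact: (congr1 s1 (esym eh)).
- move=> f; have /(res_exact res)[v ev'] : d 0%N (s1 (Psi f)) = 0.
    by apply/d00/Phi_eq0; apply: homP => g; exact: phi_psi.
  by exists v.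
- apply: (@superfluous_rad _ _ _ _ n_gt1 C t22) => f /eqP hf; apply: Psi_filt.
  by apply: (can_inj s1K); rewrite linear0 -[RHS]hf.
(* The nonzero element activates the descending condition in degree 1, which is imposed on nonzero
   terms. *)
split; [exact: LL_P33_le t1K | exact: LL_P22_ge s2K t2K | exists (s1 u33)].
apply/eqP => e; case/eqP: u33_neq0; apply: (can_inj s1K).
by rewrite e linear0.
Qed.

End Resolution.

Theorem proposition5p6 (K : fieldType) (n : nat) (n_gt1 : (1 < n)%N)
    (P : nat -> lmodType (R_A K n))
    (d : forall i : nat, {linear P i.+1 -> P i})
    (aug : {linear P 0%N -> modM K n})
    (resP : min_proj_res d aug) :
  ((5 <= n)%N -> ~ descending_LL P) /\
  [/\ (LL (P 1%N) <= 6)%N, (1 + n <= LL (P 2%N))%N &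
      (5 <= n)%N -> (LL (P 1%N) <= LL (P 2%N))%N].
Proof.
have [le6 gen ex] := resolution_LL n_gt1 (algA_coordinates K n_gt1) resP.
have le12 : (5 <= n)%N -> (LL (P 1%N) <= LL (P 2%N))%N.
  by move=> n5; apply: leq_trans le6 (leq_trans _ gen).
split=> [n5 desc|]; last by split.
by have := desc 1%N isT ex; rewrite ltnNge le12.
Qed.
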